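(* For every $n\ge1$ and every $0<\varepsilon\le 1$, given an input DAG on $n$ vertices and $m$ arcs with nonnegative integer arc weights, two vertices $s$ and $t$ of it, and a capacity $C$, one can (deterministically) compute a $1-\varepsilon$ approximation of the number $N$ of $s,t$-paths of total weight at most $C$, that is, a number $Z$ with $(1-\varepsilon)N\le Z\le N$, in time $$O\!\left(m\,n^2\log\!\left(\tfrac{m}{n}\right)\varepsilon^{-1}\left\lceil\frac{\log(1/\varepsilon)}{\log n}\right\rceil\right),$$ assuming unit cost additions and comparisons on numbers with $O(\log C)$ bits.
   Context: A DAG is a finite directed graph without directed cycles. An $s,t$-path is a directed path from $s$ to $t$; its total weight is the sum of the weights of its arcs. The capacity $C$ is a nonnegative integer. Logarithms are base 2.
   Formalization: In the time bound every logarithm log x is read as max(1, log x) and the factor m as max(1, m), since the literal bound is zero, negative or undefined when m ≤ n, ε = 1 or n = 1. *)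

(* Defs.v *)
From HB Require Import structures.
From mathcomp Require Import all_boot all_order all_algebra.
From mathcomp Require Import reals exp.

Set Implicit Arguments.
Unset Strict Implicit.
Unset Printing Implicit Defensive.

Import Order.TTheory GRing.Theory Num.Theory.

(* Directed graphs are simple: the arcs form a relation on the vertices.
   The case of a one-element sequence excludes loops. *)
Definition acyclic (V : eqType) (arc : rel V) : Prop :=
  forall c : seq V, cycle arc c -> c = [::].

(* A path is given by its vertices after the first one; since they are
   distinct, their number is at most [#|V|].  For [s = t] the empty path,
   of weight 0, counts. *)
Definition is_path (V : eqType) (arc : rel V) (s t : V) (p : seq V) : bool :=
  [&& path arc s p, last s p == t & uniq (s :: p)].

Definition path_weight (V : Type) (wt : V -> V -> nat) (s : V) (p : seq V) :=
  sumn (pairmap wt s p).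

Definition num_paths (V : finType) (arc : rel V) (wt : V -> V -> nat)
    (s t : V) (C : nat) : nat :=
  #|[set p : #|V|.-bseq V | is_path arc s t p && (path_weight wt s p <= C)]|.

(* A deterministic RAM with structured control flow.
   A program uses finitely many registers and finitely many arrays, which are
   unbounded and indexed by naturals.  Cells hold naturals of any size, but the
   cost of an operation grows with the number of machine words of its
   operands.  There is no multiplication or division, only shifts. *)
Inductive expr : Type :=
| Const of nat
| Reg of nat
| Get of nat & expr        (* cell [expr] of the given array *)
| Add of expr & expr
| Sub of expr & expr       (* truncated at 0 *)
| Shl of expr & expr
| Shr of expr & expr.

Inductive test : Type :=
| Leq of expr & expr
| Eq of expr & expr
| Not of test
| And of test & test.

Inductive cmd : Type :=
| Skip
| Set_ of nat & expr           (* register := expr *)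
| Put of nat & expr & expr     (* array[expr] := expr *)
| Seq of cmd & cmd
| If of test & cmd & cmd
| While of test & cmd.

Record state := State { reg : nat -> nat; mem : nat -> nat -> nat }.

Definition upd (T : Type) (f : nat -> T) (i : nat) (v : T) : nat -> T :=
  fun j => if j == i then v else f j.

Definition set_reg (x v : nat) (sg : state) : state :=
  State (upd (reg sg) x v) (mem sg).

Definition set_mem (a i v : nat) (sg : state) : state :=
  State (reg sg) (upd (mem sg) a (upd (mem sg a) i v)).

Fixpoint eval (sg : state) (e : expr) : nat :=
  match e with
  | Const k => k
  | Reg x => reg sg x
  | Get a e1 => mem sg a (eval sg e1)
  | Add e1 e2 => eval sg e1 + eval sg e2
  | Sub e1 e2 => eval sg e1 - eval sg e2
  | Shl e1 e2 => eval sg e1 * 2 ^ eval sg e2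
  | Shr e1 e2 => eval sg e1 %/ 2 ^ eval sg e2
  end.

Fixpoint holds (sg : state) (b : test) : bool :=
  match b with
  | Leq e1 e2 => eval sg e1 <= eval sg e2
  | Eq e1 e2 => eval sg e1 == eval sg e2
  | Not b1 => ~~ holds sg b1
  | And b1 b2 => holds sg b1 && holds sg b2
  end.

(* Length of the binary expansion, i.e. the ceiling of log2 (x + 1). *)
Definition nbits (x : nat) : nat := up_log 2 x.+1.

(* The cost of handling a number of [b] bits with words of [l] bits is
   [1 + floor (b / l)], so it is constant on numbers of [O(l)] bits. *)
Definition words (l b : nat) : nat := (b %/ l).+1.

(* Two word lengths: [l], of order log n, for addressing, subtractions and
   shifts, and [L], of order log n + log C, for additions, comparisons and data
   movement; so additions and comparisons have unit cost on numbers of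
   O(log C) bits.  A comparison scans its operands in parallel from the least
   significant word and stops at the end of the shorter one, hence [minn].
   Reading an operand in place costs only its addressing. *)
Fixpoint ecost (l L : nat) (sg : state) (e : expr) : nat :=
  match e with
  | Const _ | Reg _ => 1
  | Get _ e1 => ecost l L sg e1 + words l (nbits (eval sg e1))
  | Add e1 e2 => ecost l L sg e1 + ecost l L sg e2
      + words L (nbits (eval sg e1) + nbits (eval sg e2))
  | Sub e1 e2 | Shr e1 e2 => ecost l L sg e1 + ecost l L sg e2
      + words l (nbits (eval sg e1) + nbits (eval sg e2))
  | Shl e1 e2 => ecost l L sg e1 + ecost l L sg e2
      + words l (nbits (eval sg e1 * 2 ^ eval sg e2) + nbits (eval sg e2))
  end.

Fixpoint tcost (l L : nat) (sg : state) (b : test) : nat :=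
  match b with
  | Leq e1 e2 | Eq e1 e2 => ecost l L sg e1 + ecost l L sg e2
      + words L (minn (nbits (eval sg e1)) (nbits (eval sg e2)))
  | Not b1 => (tcost l L sg b1).+1
  | And b1 b2 => (tcost l L sg b1 + tcost l L sg b2).+1
  end.

(* [exec l L P sg k sg']: started in [sg], [P] halts in [sg'] after time [k]. *)
Inductive exec (l L : nat) : cmd -> state -> nat -> state -> Prop :=
| exec_skip sg : exec l L Skip sg 1 sg
| exec_set sg x e :
    exec l L (Set_ x e) sg
      (ecost l L sg e + words L (nbits (eval sg e)))
      (set_reg x (eval sg e) sg)
| exec_put sg a e1 e2 :
    exec l L (Put a e1 e2) sg
      (ecost l L sg e1 + words l (nbits (eval sg e1))
       + ecost l L sg e2 + words L (nbits (eval sg e2)))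
      (set_mem a (eval sg e1) (eval sg e2) sg)
| exec_seq P1 P2 sg k1 sg1 k2 sg2 :
    exec l L P1 sg k1 sg1 -> exec l L P2 sg1 k2 sg2 ->
    exec l L (Seq P1 P2) sg (k1 + k2) sg2
| exec_if_true b P1 P2 sg k sg1 :
    holds sg b -> exec l L P1 sg k sg1 ->
    exec l L (If b P1 P2) sg (tcost l L sg b + k) sg1
| exec_if_false b P1 P2 sg k sg1 :
    ~~ holds sg b -> exec l L P2 sg k sg1 ->
    exec l L (If b P1 P2) sg (tcost l L sg b + k) sg1
| exec_while_true b P1 sg k1 sg1 k2 sg2 :
    holds sg b -> exec l L P1 sg k1 sg1 -> exec l L (While b P1) sg1 k2 sg2 ->
    exec l L (While b P1) sg (tcost l L sg b + k1 + k2) sg2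
| exec_while_false b P1 sg :
    ~~ holds sg b -> exec l L (While b P1) sg (tcost l L sg b) sg.

Lemma exec_det l L P sg k1 sg1 k2 sg2 :
  exec l L P sg k1 sg1 -> exec l L P sg k2 sg2 -> k1 = k2 /\ sg1 = sg2.
Proof.
move=> H; elim: H k2 sg2; intros;
  match goal with h : exec _ _ _ _ _ _ |- _ => inversion h; subst; clear h end;
  try (match goal with h : is_true (~~ ?b), h' : is_true ?b |- _ =>
         by rewrite h' in h end);
  repeat match goal with
  | ih : forall k sg', exec l L ?P ?sg k sg' -> _,
    h : exec l L ?P ?sg _ _ |- _ => case: (ih _ _ h) => ? ?; subst; clear h
  end; by [].
Qed.

(* Registers 0 to 5 hold n, m, s, t, C and [E]; arrays 0, 1 and 2 hold the
   tails, the heads and the weights of the arcs, in the order of [arcs];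
   everything else is 0.  Since a real epsilon cannot be read by a machine, it is
   given through the integer [E], the ceiling of 1 / epsilon. *)
Definition init_state (n : nat) (arcs : seq ('I_n * 'I_n))
    (wt : 'I_n -> 'I_n -> nat) (s t : 'I_n) (C E : nat) : state :=
  State
    (nth 0 [:: n; size arcs; s : nat; t : nat; C; E])
    (fun a => nth 0 (nth [::]
       [:: [seq (val uv.1) | uv <- arcs];
           [seq (val uv.2) | uv <- arcs];
           [seq wt uv.1 uv.2 | uv <- arcs]] a)).

Definition out_reg : nat := 0.

Local Open Scope ring_scope.

(* The binary logarithm of a running time, with the usual convention that it is
   at least 1; without it the bound is 0, negative or undefined when m <= n,
   when epsilon = 1 or when n = 1. *)
Definition lg (R : realType) (x : R) : R := Num.max 1 (ln x / ln 2%:R).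

(* For m = 0 the factor m is read as 1, as no program runs in time 0. *)
Definition time_bound (R : realType) (n m : nat) (eps : R) : R :=
  (maxn 1 m)%:R * n%:R ^+ 2 * lg (m%:R / n%:R) * eps^-1
  * (Num.ceil (lg eps^-1 / lg n%:R))%:~R.

(* Main.v *)
(* Let F v c be the number of paths of weight at most c from v to t, so that F v
   is the sum, over the arcs (v, u), of F u shifted by the weight of the arc,
   plus 1 if v = t.
   Each F v is stored through thresholds: for every k, the least c at which an
   approximation of F v reaches G k, where G k runs through the floating-point
   numbers with mantissas below 2 M.  The thresholds of a sum of two functions
   are found by merging two lists, with a relative error of at most 2 / M.

   The d lists of a vertex are merged pairwise in first-in first-out order, hence
   in a balanced tree, where every list takes part in at most log2 (2 d) merges.
   By concavity of the logarithm these depths sum up to O(n log (m / n)) over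
   all vertices, and so do the relative errors, in units of 2 / M, so
   M = O(n log (m / n) / eps) suffices.  A DAG has at most 2 ^ n paths from v to
   t, so that a list needs only (n + 2) M entries; there are at most two lists
   for every arc, which accounts for the factor m n of the running time. *)
Require Import Defs.
From mathcomp Require Import all_boot all_order all_algebra.
From mathcomp Require Import reals exp.
From mathcomp Require Import lra ring.
From Stdlib Require Import Lia.
From mathcomp.zify Require Import zify_ssreflect.
(* so that [mem] is again the memory of a state *)
Import Defs.

Set Implicit Arguments.
Unset Strict Implicit.
Unset Printing Implicit Defensive.

(** Counts may have n bits, and the machine pays for every word and cannot multiply, so merging must
    never form them. A comparison of G k with G i + G j is therefore made on mantissas alone, both
    summands being shifted down to the exponent of G k. Each shift loses less than one unit in the
    last place of G k; two units against a mantissa of at least M are the origin of the error 2 / M.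
    Errors are kept in the linear form F M <= G M + 2 r F: a shift by an arc weight leaves r
    unchanged, a merge adds 1. A single r serves all lists and grows with every processed vertex, so
    it is bounded by a sum over all vertices and not by a maximum over paths. Neither adjacency
    lists nor a topological order are computed. In each of n rounds every unprocessed vertex scans
    all arcs to see whether its successors are done; these scans cost O(m n^2), which is within m K
    since K >= n^2. *)

Local Notation "P ;; Q" := (Seq P Q) (at level 60, right associativity).

(** * Weakest preconditions with costs *)

Lemma nbits_le x : nbits x <= x.
Proof. by rewrite /nbits up_log_min // ltn_expl. Qed.

Lemma words_le l b : words l b <= b.+1.
Proof. by rewrite /words ltnS leq_div. Qed.

Lemma nbits_le_exp x n : x <= 2 ^ n -> nbits x <= n.+1.
Proof.
move=> h; rewrite /nbits up_log_min // (leq_ltn_trans h) // ltn_exp2l //.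
Qed.

Lemma ltn_nbits x : x < 2 ^ nbits x.
Proof. exact: up_logP. Qed.

Lemma nbits_lt_exp x k : x < 2 ^ k -> nbits x <= k.
Proof. by move=> h; rewrite /nbits up_log_min. Qed.

Lemma leq_words l b1 b2 : b1 <= b2 -> words l b1 <= words l b2.
Proof. by move=> h; rewrite /words ltnS leq_div2r. Qed.

Lemma leq_nbits x y : x <= y -> nbits x <= nbits y.
Proof. by move=> h; rewrite /nbits leq_up_log. Qed.

Fixpoint esize (e : expr) : nat :=
  match e with
  | Const _ | Reg _ => 1
  | Get _ e1 => (esize e1).+1
  | Add e1 e2 | Sub e1 e2 | Shl e1 e2 | Shr e1 e2 => (esize e1 + esize e2).+1
  end.

Fixpoint tsize (b : test) : nat :=
  match b with
  | Leq e1 e2 | Eq e1 e2 => (esize e1 + esize e2).+1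
  | Not b1 => (tsize b1).+1
  | And b1 b2 => (tsize b1 + tsize b2).+1
  end.

Fixpoint csize (P : cmd) : nat :=
  match P with
  | Skip => 1
  | Set_ _ e => (esize e).+1
  | Put _ e1 e2 => (esize e1 + esize e2).+2
  | Seq P1 P2 => csize P1 + csize P2
  | If b P1 P2 => tsize b + (csize P1 + csize P2)
  | While b P1 => tsize b + csize P1
  end.

(* Meant for loop-free commands: a loop is left unexecuted. *)
Fixpoint sexec (P : cmd) (sg : state) : state :=
  match P with
  | Skip | While _ _ => sg
  | Set_ x e => set_reg x (eval sg e) sg
  | Put a e1 e2 => set_mem a (eval sg e1) (eval sg e2) sg
  | Seq P1 P2 => sexec P2 (sexec P1 sg)
  | If b P1 P2 => if holds sg b then sexec P1 sg else sexec P2 sg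
  end.

Section Safety.

(* [X] bounds addresses and other short numbers, [Y] bounds all numbers. *)
Variables X Y : nat.

Fixpoint esafe (sg : state) (e : expr) : Prop :=
  match e with
  | Const _ | Reg _ => True
  | Get _ e1 => esafe sg e1 /\ eval sg e1 <= X
  | Add e1 e2 =>
      [/\ esafe sg e1, esafe sg e2, eval sg e1 <= Y & eval sg e2 <= Y]
  | Sub e1 e2 | Shr e1 e2 =>
      [/\ esafe sg e1, esafe sg e2, eval sg e1 <= X & eval sg e2 <= X]
  | Shl e1 e2 =>
      [/\ esafe sg e1, esafe sg e2, eval sg e1 * 2 ^ eval sg e2 <= X
        & eval sg e2 <= X]
  end.

(** For a comparison one bounded operand is enough, since the shorter operand determines the cost.
    Arc weights are unbounded, but the program compares them with C before using them in any other
    way. *)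
Fixpoint tsafe (sg : state) (b : test) : Prop :=
  match b with
  | Leq e1 e2 | Eq e1 e2 =>
      [/\ esafe sg e1, esafe sg e2 & eval sg e1 <= Y \/ eval sg e2 <= Y]
  | Not b1 => tsafe sg b1
  | And b1 b2 => tsafe sg b1 /\ tsafe sg b2
  end.

Fixpoint csafe (sg : state) (P : cmd) : Prop :=
  match P with
  | Skip => True
  | Set_ _ e => esafe sg e /\ eval sg e <= Y
  | Put _ e1 e2 =>
      [/\ esafe sg e1, esafe sg e2, eval sg e1 <= X & eval sg e2 <= Y]
  | Seq P1 P2 => csafe sg P1 /\ csafe (sexec P1 sg) P2
  | If b P1 P2 =>
      tsafe sg b /\ (if holds sg b then csafe sg P1 else csafe sg P2)
  | While _ _ => False
  end.

Variables l L U : nat.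
Hypothesis short_unit : words l (nbits X + nbits X) <= U.
Hypothesis long_unit : words L (nbits Y + nbits Y) <= U.

Let unit_gt0 : 0 < U.
Proof. exact: leq_trans short_unit. Qed.

Let short1 x : x <= X -> words l (nbits x) <= U.
Proof.
move=> h; apply: leq_trans short_unit; apply: leq_words.
by rewrite -[nbits x]addn0 leq_add // leq_nbits.
Qed.

Let short2 x y : x <= X -> y <= X -> words l (nbits x + nbits y) <= U.
Proof.
by move=> h1 h2; apply: leq_trans short_unit; rewrite leq_words ?leq_add ?leq_nbits.
Qed.

Let long1 x : x <= Y -> words L (nbits x) <= U.
Proof.
move=> h; apply: leq_trans long_unit; apply: leq_words.
by rewrite -[nbits x]addn0 leq_add // leq_nbits.
Qed.

Let long2 x y : x <= Y -> y <= Y -> words L (nbits x + nbits y) <= U.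
Proof.
by move=> h1 h2; apply: leq_trans long_unit; rewrite leq_words ?leq_add ?leq_nbits.
Qed.

Let long_min x y : x <= Y \/ y <= Y -> words L (minn (nbits x) (nbits y)) <= U.
Proof.
case=> h; apply: leq_trans (long1 h); apply: leq_words.
  exact: geq_minl.
exact: geq_minr.
Qed.

Lemma ecost_safe sg e : esafe sg e -> ecost l L sg e <= esize e * U.
Proof.
elim: e => [?|?|a e IH|e IH f IHf|e IH f IHf|e IH f IHf|e IH f IHf] /=;
  rewrite ?mul1n // ?mulSn ?mulnDl.
- by case=> /IH h /short1 h'; rewrite addnC leq_add.
- by case=> /IH h1 /IHf h2 k1 k2; rewrite addnC leq_add ?leq_add // long2.
- by case=> /IH h1 /IHf h2 k1 k2; rewrite addnC leq_add ?leq_add // short2.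
- by case=> /IH h1 /IHf h2 k1 k2; rewrite addnC leq_add ?leq_add // short2.
- by case=> /IH h1 /IHf h2 k1 k2; rewrite addnC leq_add ?leq_add // short2.
Qed.

Lemma tcost_safe sg b : tsafe sg b -> tcost l L sg b <= tsize b * U.
Proof.
elim: b => [e f|e f|b IH|b IH c IHc] /=; rewrite ?mulSn ?mulnDl.
- by case=> /ecost_safe h1 /ecost_safe h2 /long_min h3; rewrite addnC leq_add ?leq_add.
- by case=> /ecost_safe h1 /ecost_safe h2 /long_min h3; rewrite addnC leq_add ?leq_add.
- by move/IH => h; rewrite -[(tcost _ _ _ _).+1]add1n leq_add.
- by case=> /IH h1 /IHc h2; rewrite -[(_ + _).+1]add1n leq_add ?leq_add.
Qed.

(** Each operation costs at most U per symbol of the program text. The time of loop-free code is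
    thus bounded by its length, and timing it reduces to bounding the numbers that occur. *)
Lemma exec_sexec P sg : csafe sg P ->
  exists2 k, exec l L P sg k (sexec P sg) & k <= csize P * U.
Proof.
elim: P sg => [|x e|a e f|P IHP Q IHQ|b P IHP Q IHQ|//] sg /=;
  rewrite ?mulSn ?mulnDl.
- by move=> _; exists 1; [constructor | rewrite mul0n addn0].
- case=> /ecost_safe h1 /long1 h2; eexists; first by constructor.
  by rewrite addnC leq_add.
- case=> /ecost_safe h1 /ecost_safe h2 /short1 h3 /long1 h4; eexists.
    by constructor.
  lia.
- case=> /IHP [k1 h1 c1] /IHQ [k2 h2 c2]; exists (k1 + k2); last exact: leq_add.
  exact: exec_seq h1 h2.
- case=> /tcost_safe ht; case: ifP => hb.
    move=> /IHP [k h c]; eexists; first exact: exec_if_true h.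
    by rewrite leq_add // (leq_trans c) ?leq_addr.
  move=> /IHQ [k h c]; eexists; first by apply: exec_if_false h; rewrite hb.
  by rewrite leq_add // (leq_trans c) ?leq_addl.
Qed.

Definition wp (P : cmd) (sg : state) (tau : nat) (Q : state -> Prop) : Prop :=
  exists k sg', [/\ exec l L P sg k sg', k <= tau & Q sg'].

Lemma wp_weaken P sg tau tau' (Q Q' : state -> Prop) :
  wp P sg tau Q -> tau <= tau' -> (forall sg', Q sg' -> Q' sg') ->
  wp P sg tau' Q'.
Proof.
move=> [k [sg' [h1 h2 h3]]] h4 h5; exists k, sg'; split=> //; last exact: h5.
exact: leq_trans h4.
Qed.

Lemma wp_straight P sg (Q : state -> Prop) :
  csafe sg P -> Q (sexec P sg) -> wp P sg (csize P * U) Q.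
Proof. by move=> /exec_sexec [k h1 h2] hq; exists k, (sexec P sg). Qed.

Lemma wp_seq P1 P2 sg t1 t2 Q :
  wp P1 sg t1 (fun sg1 => wp P2 sg1 t2 Q) -> wp (Seq P1 P2) sg (t1 + t2) Q.
Proof.
move=> [k1 [sg1 [h1 c1 [k2 [sg2 [h2 c2 hq]]]]]].
by exists (k1 + k2), sg2; split=> //; [exact: exec_seq h1 h2 | exact: leq_add].
Qed.

Lemma wp_if b P1 P2 sg t Q :
  tsafe sg b -> wp (if holds sg b then P1 else P2) sg t Q ->
  wp (If b P1 P2) sg (tsize b * U + t) Q.
Proof.
move=> /tcost_safe hb; case: ifP => h [k [sg' [h1 h2 h3]]];
  exists (tcost l L sg b + k), sg'; split=> //; try exact: leq_add.
  exact: exec_if_true h1.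
by apply: exec_if_false h1; rewrite h.
Qed.

(* The index of the invariant is the time spent so far, out of [tau]. *)
Lemma wp_while_budget b P tau (I : nat -> state -> Prop) (Q : state -> Prop) sg :
  (forall i sg, I i sg ->
     [/\ tsafe sg b, i + tsize b * U <= tau &
      if holds sg b then exists t, wp P sg t (fun sg' =>
         exists2 i', i + tsize b * U + t <= i' & I i' sg')
      else Q sg]) ->
  I 0 sg -> wp (While b P) sg tau Q.
Proof.
move=> step; suff: forall d i sg, tau - i <= d -> I i sg ->
    wp (While b P) sg (tau - i) Q by move=> h /(h _ _ _ (leqnn _)); rewrite subn0.
(* Every evaluation of the test uses up a positive amount of time, so the remaining budget is also
   the termination measure. *)
have tb_gt0 : 0 < tsize b * U by rewrite muln_gt0 unit_gt0; case: (b).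
elim=> [|d IH] i {}sg hd /[dup] hI /step [/tcost_safe hs hi].
  by move: hd hi tb_gt0; lia.
case: ifP => hb; last first.
  move=> hq; exists (tcost l L sg b), sg; split=> //; last lia.
  by apply: exec_while_false; rewrite hb.
move=> [t [k [sg' [h1 h2 [i' h3 h4]]]]].
have hd' : tau - i' <= d by lia.
have [k' [sg'' [h5 h6 h7]]] := IH i' sg' hd' h4.
have [/tcost_safe _ hi' _] := step _ _ h4.
exists (tcost l L sg b + k + k'), sg''; split=> //; last lia.
exact: exec_while_true h1 h5.
Qed.

Lemma wp_while b P n t (I : nat -> state -> Prop) (Q : state -> Prop) sg :
  (forall i sg, I i sg -> tsafe sg b /\
      if holds sg b then i < n /\ wp P sg t (I i.+1) else i <= n /\ Q sg) ->
  I 0 sg -> wp (While b P) sg (n * (t + tsize b * U) + tsize b * U) Q.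
Proof.
move=> step hI; set tb := tsize b * U.
apply: (@wp_while_budget _ _ _
  (fun j sg => exists i, j = i * (t + tb) /\ I i sg)); last by exists 0.
move=> _ {hI}sg [i [-> /step [hs]]]; case: ifP => hb [hi hw]; split=> //.
- rewrite -/tb; have : i.+1 * (t + tb) <= n * (t + tb) by rewrite leq_mul2r hi orbT.
  by rewrite mulSn; lia.
- exists t; apply: wp_weaken hw (leqnn _) _ => sg' h.
  exists (i.+1 * (t + tb)); first by rewrite -/tb mulSn; lia.
  by exists i.+1.
- by rewrite -/tb leq_add2r leq_mul2r hi orbT.
Qed.

End Safety.

(** * Approximate step functions and their sums *)

Section Grid.

Variable M : nat.
Hypothesis M_gt1 : 1 < M.

(* Floating-point numbers with mantissas below [2 M], in increasing order. *)
Fixpoint grid (k : nat) : nat * nat :=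
  if k is k'.+1 then
    let: (a, e) := grid k' in
    if a.+1 == M + M then (M, e.+1) else (a.+1, e)
  else (0, 0).

Definition mant k := (grid k).1.
Definition expo k := (grid k).2.
Definition gval k := mant k * 2 ^ expo k.

Lemma grid_spec k :
  [/\ k = M * expo k + mant k, mant k < M + M & 0 < expo k -> M <= mant k].
Proof.
elim: k => [|k [IH1 IH2 IH3]]; first by rewrite /mant /expo /= muln0; split; lia.
rewrite /mant /expo /= in IH1 IH2 IH3 *; case: (grid k) IH1 IH2 IH3 => a e /= h1 h2 h3.
by case: eqP => h /=; split; nia.
Qed.

Lemma gvalS k : gval k.+1 = gval k + 2 ^ expo k.
Proof.
rewrite /gval /mant /expo /=; case: (grid k) => a e /=.
case: eqP => h /=; last by rewrite mulSn addnC.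
by rewrite expnS mulnA muln2 -addnn -h mulSn addnC.
Qed.

Lemma leq_gval k1 k2 : k1 <= k2 -> gval k1 <= gval k2.
Proof.
move/subnKC <-; elim: (k2 - k1) => [|d IH]; first by rewrite addn0.
by rewrite addnS gvalS (leq_trans IH) ?leq_addr.
Qed.

Lemma leq_expo k1 k2 : k1 <= k2 -> expo k1 <= expo k2.
Proof.
move/subnKC <-; elim: (k2 - k1) => [|d IH]; first by rewrite addn0.
rewrite addnS (leq_trans IH) // /expo /=; case: (grid _) => a e /=.
by case: ifP => _ /=.
Qed.

(** Index (n + 2) M has mantissa M and exponent n + 1. This is where the length K of the lists comes
    from. *)
Lemma gval_large n : 2 ^ n < gval (n.+2 * M).
Proof.
have [h1 h2 h3] := grid_spec (n.+2 * M).
have he : n < expo (n.+2 * M) by nia.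
rewrite (@leq_trans (M * 2 ^ n)) //.
  by rewrite -[X in X < _]mul1n ltn_mul2r expn_gt0 M_gt1.
by rewrite leq_mul ?leq_pexp2l ?h3 //; lia.
Qed.

Lemma expo_le n k : k <= n.+2 * M -> expo k <= n.+2.
Proof. by have [h1 h2 h3] := grid_spec k => h; nia. Qed.

(** A test for G k <= G i + G j that touches only mantissas. Differences of exponents are truncated
    at 0; this is harmless because a merge keeps [i] and [j] at most [k]. *)
Definition emit i j k :=
  mant k <= mant i %/ 2 ^ (expo k - expo i) + mant j %/ 2 ^ (expo k - expo j).

Lemma emitC i j k : emit i j k = emit j i k.
Proof. by rewrite /emit addnC. Qed.

(** The reason why no pointer of a merge overtakes the output index. *)
Lemma emit_refl k j : emit k j k.
Proof. by rewrite /emit subnn expn0 divn1 leq_addr. Qed.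

Let scaled i k := mant i %/ 2 ^ (expo k - expo i).

Let scaled_le i k : scaled i k * 2 ^ expo k <= gval i.
Proof.
rewrite /gval (@leq_trans (scaled i k * 2 ^ (expo k - expo i) * 2 ^ expo i)) //.
  by rewrite -mulnA -expnD leq_mul2l leq_exp2l //; apply/orP; right; lia.
by rewrite leq_mul2r leq_divM orbT.
Qed.

Let scaled_gt i k : i <= k -> gval i < (scaled i k).+1 * 2 ^ expo k.
Proof.
move=> /leq_expo h; rewrite /gval -{1}(subnK h) expnD mulnA ltn_mul2r expn_gt0 /=.
by rewrite ltn_ceil // expn_gt0.
Qed.

Lemma emit_gval i j k : emit i j k -> gval k <= gval i + gval j.
Proof.
rewrite /emit => h; apply: leq_trans (leq_add (scaled_le i k) (scaled_le j k)).
by rewrite -mulnDl leq_mul2r h orbT.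
Qed.

(** Let x be the mantissa and p the scale of G (k + 1). A failed test leaves the sum below (x + 1)
    p, one lost unit per summand, whereas G k is at least (x - 1) p. Since x >= M, the quotient is
    at least 1 - 2 / M. *)
Lemma not_emit_gval i j k : i <= k.+1 -> j <= k.+1 -> ~~ emit i j k.+1 ->
  (gval i + gval j) * M <= gval k * M + 2 * (gval i + gval j).
Proof.
move=> hi hj; rewrite /emit -ltnNge => h.
have := scaled_gt hi; have := scaled_gt hj; rewrite -/(scaled _ _) in h.
rewrite -/(scaled j k.+1) in h.
have := gvalS k; have := leq_expo (leqnSn k).
have [_ _] := grid_spec k.+1; rewrite {1}/gval; set x := mant k.+1 in h *.
set e := expo k.+1; set e' := expo k.
(* At exponent 0 the shifts lose nothing and the comparison is exact; the bound x >= M is available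
   only for positive exponents. *)
case: (posnP e) => [->|he].
  rewrite leqn0 => _ /eqP-> /=; rewrite expn0 !muln1 => h1 h2 h3.
  have : gval i + gval j <= gval k by lia.
  by move=> h4; rewrite (leq_trans _ (leq_addr _ _)) // leq_mul2r h4 orbT.
move=> /(_ isT) hx he'; have : 2 ^ e' <= 2 ^ e by rewrite leq_exp2l.
set p := 2 ^ e; set p' := 2 ^ e'; set gi := gval i; set gj := gval j.
move=> hp hk h1 h2.
have h3 : gi + gj <= x.+1 * p.
  have : (scaled i k.+1 + scaled j k.+1) * p + 2 * p <= x.+1 * p.
    by rewrite -mulnDl leq_mul2r; apply/orP; right; lia.
  rewrite mulnDl; lia.
have h4 : x.-1 * p <= gval k by nia.
have h5 : x.+1 * (M - 2) <= x.-1 * M by nia.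
have h6 : (gi + gj) * (M - 2) <= gval k * M.
  apply: (@leq_trans (x.+1 * p * (M - 2))); first by rewrite leq_mul2r h3 orbT.
  apply: (@leq_trans (x.-1 * p * M)); last by rewrite leq_mul2r h4 orbT.
  by rewrite -!mulnA ![p * _]mulnC !mulnA leq_mul2r h5 orbT.
by move: h6; rewrite mulnBr; lia.
Qed.

End Grid.

(** * Threshold lists and their merging *)

Section Lists.

Variables M K C : nat.
Hypothesis M_gt1 : 1 < M.
Hypothesis K_gt0 : 0 < K.

Let G := gval M.

(* [T k] is a threshold from which on [F] is at least [G k]; conversely the
   largest [G k] whose threshold is passed is at least [(1 - 2 r / M) F]. *)
Record approx (T : nat -> nat) (F : nat -> nat) (r : nat) : Prop := Approx {
  approx0 : T 0 = 0;
  approx_mono : forall k, k < K -> T k <= T k.+1;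
  approx_last : T K = C.+1;
  approx_sound : forall c k, c <= C -> k <= K -> T k <= c -> G k <= F c;
  approx_complete : forall c, c <= C -> exists k,
    [/\ k <= K, T k <= c & F c * M <= G k * M + 2 * r * F c] }.

Lemma approx_leq T F r k1 k2 :
  approx T F r -> k1 <= k2 -> k2 <= K -> T k1 <= T k2.
Proof.
move=> h /subnKC <-; elim: (k2 - k1) => [|d IH]; first by rewrite addn0.
rewrite addnS => hK; apply: (leq_trans (IH (ltnW hK))).
exact: approx_mono h _ hK.
Qed.

Lemma approx_le_last T F r k : approx T F r -> k <= K -> T k <= C.+1.
Proof. by move=> h hk; rewrite -(approx_last h) (approx_leq h). Qed.

Lemma approx_weaken T F r r' : approx T F r -> r <= r' -> approx T F r'.
Proof.
case=> h0 h1 h2 h3 h4 hr; split=> // c /h4 [k [hk hT hF]]; exists k; split=> //.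
by apply: (leq_trans hF); rewrite leq_add2l leq_mul2r leq_mul2l hr !orbT.
Qed.

Lemma approx_eq T T' F F' r : (forall k, k <= K -> T k = T' k) ->
  (forall c, c <= C -> F c = F' c) -> approx T F r -> approx T' F' r.
Proof.
move=> hT hF [h0 h1 h2 h3 h4]; split.
- by rewrite -hT.
- by move=> k hk; rewrite -!hT ?h1 //; lia.
- by rewrite -hT.
- by move=> c k hc hk; rewrite -hT // -hF //; apply: h3.
- move=> c hc; have [k [hk h5 h6]] := h4 c hc; exists k.
  by rewrite -hT // -hF.
Qed.

(** Below [w] the shifted function is 0, and the entry 0, with grid value 0, has to stay at
    threshold 0 to represent this. Capping at C + 1 keeps the thresholds short and loses nothing, as
    only capacities up to C matter. *)
Lemma approx_shift T F r w T' : approx T F r -> w <= C -> T' 0 = 0 ->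
  (forall k, 0 < k -> k <= K -> T' k = minn (T k + w) C.+1) ->
  approx T' (fun c => if w <= c then F (c - w) else 0) r.
Proof.
move=> hT hw h0 hS; split=> //.
- move=> [|k] hk; first by rewrite h0.
  by rewrite !hS ?(ltnW hk) //; have := approx_mono hT hk; lia.
- by rewrite hS // (approx_last hT); lia.
- move=> c [|k] hc hk; first by [].
  rewrite hS // => h; have -> : w <= c by lia.
  apply: (approx_sound hT) => //; lia.
- move=> c hc; case: leqP => hwc; last first.
    by exists 0; rewrite h0 muln0.
  have hc' : c - w <= C by lia.
  have [[|k] [hk h1 h2]] := approx_complete hT hc'; first by exists 0; rewrite h0.
  by exists k.+1; rewrite hS //; split=> //; lia.
Qed.

(** A merge sweeps the capacity upwards: [cur] is the current capacity, [i] and [j] are the entries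
    reached in the two lists, [k] is the next output entry. Thresholds may coincide, so at [cur]
    itself the pointers may lag behind; hence completeness only strictly below [cur]. *)
Record merging (A B : nat -> nat) (i j k cur : nat) (R : nat -> nat) : Prop :=
  Merging {
  mg_i : [/\ i <= k, i <= K, A i <= cur & i < K -> cur <= A i.+1];
  mg_j : [/\ j <= k, j <= K, B j <= cur & j < K -> cur <= B j.+1];
  mg_cur : cur <= C.+1;
  mg_k : if k is 0 then cur = 0 else R 0 = 0;
  mg_bound : forall k', k' < k -> R k' <= cur;
  mg_mono : forall k', k'.+1 < k -> R k' <= R k'.+1;
  mg_sound : forall k', k' < k -> R k' <= C -> exists i' j',
    [/\ i' <= K, j' <= K, A i' <= R k', B j' <= R k' & G k' <= G i' + G j'];
  mg_complete : forall c, c < cur -> exists k',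
    [/\ k' < k, R k' <= c & forall i' j', i' <= K -> j' <= K ->
      A i' <= c -> B j' <= c ->
      (G i' + G j') * M <= G k' * M + 2 * (G i' + G j')] }.

Lemma merging_sym A B i j k cur R :
  merging A B i j k cur R -> merging B A j i k cur R.
Proof.
case=> h1 h2 h3 h4 h5 h6 h7 h8; split=> //.
- move=> k' hk hC; have [i' [j' [? ? ? ? ?]]] := h7 k' hk hC.
  by exists j', i'; rewrite addnC.
- move=> c /h8 [k' [? ? h]]; exists k'; split=> // i' j' ? ? ? ?.
  by rewrite addnC h.
Qed.

Section Merge.

Variables (A B : nat -> nat) (F1 F2 : nat -> nat) (r : nat).
Hypotheses (hA : approx A F1 r) (hB : approx B F2 r).

Lemma merging_init R : merging A B 0 0 0 0 R.
Proof. by split=> //; rewrite ?(approx0 hA) ?(approx0 hB). Qed.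

(** Beyond C no test is required: this is how the rest of the output is padded with C + 1. *)
Lemma merging_emit i j k cur R R' :
  merging A B i j k cur R -> (C < cur) || emit M i j k ->
  R' k = cur -> (forall k', k' < k -> R' k' = R k') ->
  merging A B i j k.+1 cur R'.
Proof.
case=> [[hi1 hi2 hi3 hi4] [hj1 hj2 hj3 hj4] hc hk hb hm hs hcp] he hR hR'.
split=> //.
- by split=> //; lia.
- by split=> //; lia.
- by case: (k) hk hR hR' => [|k'] h h' h''; [rewrite h' | rewrite h''].
- move=> k'; rewrite ltnS leq_eqVlt => /orP[/eqP->|h]; first by rewrite hR.
  by rewrite hR' // hb.
- move=> k'; rewrite ltnS leq_eqVlt => /orP[/eqP h|h].
    by rewrite hR' ?h ?hR ?hb // -h.
  by rewrite !hR' ?hm //; lia.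
- move=> k'; rewrite ltnS leq_eqVlt => /orP[/eqP->|h].
    rewrite hR => h; exists i, j; split=> //.
    by move: he; rewrite ltnNge h /=; exact: emit_gval.
  by rewrite hR' //; apply: hs.
- move=> c /hcp [k' [h1 h2 h3]]; exists k'; split=> //; first exact: ltnW.
  by rewrite hR'.
Qed.

(** For capacities between the old and the new [cur], no entry after [i] or [j] is passed, while k -
    1 has already been written. The failed test for [k] makes G (k - 1) accurate enough there. *)
Lemma merging_advance i j k cur R :
  merging A B i j k cur R -> cur <= C -> ~~ emit M i j k -> j < K ->
  A i.+1 <= B j.+1 -> i < K /\ merging A B i.+1 j k (A i.+1) R.
Proof.
case=> [[hi1 hi2 hi3 hi4] [hj1 hj2 hj3 hj4] hc hk hb hm hs hcp] hcur he hjK hAB.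
have iK : i < K.
  rewrite ltn_neqAle hi2 andbT; apply/eqP => h.
  by move: hi3; rewrite h (approx_last hA); lia.
have ik : i < k.
  rewrite ltn_neqAle hi1 andbT; apply/eqP => h.
  by move: he; rewrite h emit_refl.
have hcur' := hi4 iK.
split=> //; split=> //.
- by split=> // h; exact: approx_mono hA _ h.
- by split=> //; exact: leq_trans hj3 _.
- exact: approx_le_last hA _.
- by case: (k) ik hk.
- by move=> k' /hb h; apply: leq_trans hcur'.
move=> c hc1; case: (ltnP c cur) => hc2; first exact: hcp.
case: k {hs hcp hm} ik hi1 hj1 hk hb he => // k ik hi1 hj1 hk hb he.
exists k; split=> //; first by apply: leq_trans (hb _ (ltnSn _)) hc2.
move=> i' j' hi' hj' hAi hBj.
have ii : i' <= i.
  rewrite leqNgt; apply/negP => h.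
  by have := approx_leq hA h hi'; lia.
have jj : j' <= j.
  rewrite leqNgt; apply/negP => h.
  by have := approx_leq hB h hj'; lia.
have := not_emit_gval M_gt1 hi1 hj1 he; rewrite -/G.
have := leq_gval M ii; have := leq_gval M jj; rewrite -/G.
move: (G i) (G j) (G i') (G j') (G k) => x y x' y' z h1 h2 h3.
have : (x' + y') * (M - 2) <= (x + y) * (M - 2).
  by rewrite leq_mul2r leq_add ?orbT.
by rewrite !mulnBr; lia.
Qed.

(** As G K exceeds the sum everywhere, entry K can only have been written beyond C, so the sweep has
    covered all capacities. The new error is relative to the represented values G i' + G j'; by
    soundness these are at most F1 + F2, so it adds just 1 to [r]. *)
Lemma merging_final i j cur R :
  merging A B i j K.+1 cur R -> (forall c, c <= C -> F1 c + F2 c < G K) ->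
  approx R (fun c => F1 c + F2 c) r.+1.
Proof.
case=> [[hi1 hi2 hi3 hi4] [hj1 hj2 hj3 hj4] hc hk hb hm hs hcp] hG.
have sound c k : c <= C -> k <= K -> R k <= c -> G k <= F1 c + F2 c.
  move=> hc1 hk1 hR.
  have [i' [j' [h1 h2 h3 h4 h5]]] := hs k hk1 (leq_trans hR hc1).
  apply: (leq_trans h5); apply: leq_add.
    by apply: (approx_sound hA); rewrite // (leq_trans h3).
  by apply: (approx_sound hB); rewrite // (leq_trans h4).
have hRK : C < R K.
  rewrite ltnNge; apply/negP => h; have := sound C K (leqnn _) (leqnn _) h.
  by rewrite leqNgt hG.
have hcur : cur = C.+1 by have := hb K (ltnSn _); lia.
split=> //; first by have := hb K (ltnSn _); lia.
move=> c hc1; have hlt : c < cur by rewrite hcur.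
have [k [h1 h2 h3]] := hcp c hlt.
have [i' [h4 h5 h6]] := approx_complete hA hc1.
have [j' [h7 h8 h9]] := approx_complete hB hc1.
exists k; split=> //.
have := h3 i' j' h4 h7 h5 h8.
have := approx_sound hA hc1 h4 h5; have := approx_sound hB hc1 h7 h8.
move: h6 h9; rewrite -/G.
move: (G i') (G j') (G k) (F1 c) (F2 c) => x y z f g.
by rewrite !mulnDl; nia.
Qed.

End Merge.

Lemma approx_unit T : T 0 = 0 -> T 1 = 0 ->
  (forall k, 1 < k -> k <= K -> T k = C.+1) -> 1 < K ->
  approx T (fun=> 1) 0.
Proof.
have G1 : G 1 = 1 by rewrite /G gvalS.
move=> h0 h1 h2 hK; split=> //.
- by move=> [|[|k]] hk; rewrite ?h0 ?h1 // !h2 // ltnW.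
- by rewrite h2.
- by move=> c [|[|k]] hc hk; rewrite ?G1 // h2 //; lia.
- by move=> c hc; exists 1; rewrite h1 G1; split=> //; lia.
Qed.

End Lists.

(** * The program *)

(* Registers: 0-5 input, 6 logarithm of the average degree plus 3, 7 bound on
   the total depth, 8 [M], 9 [K], 10 logarithm of the stride of array 5, 11 the
   stride, 12 round, 13 vertex, 14 first free item, 15 ready flag, 16 arc,
   17 first queued item, from 20 on scratch.
   Arrays: 0-2 arcs, 3 mantissas, 4 exponents, 5 items, 6 status of vertices:
   0 not processed, 1 no path to the target, otherwise an item. *)
Ltac safety := repeat split; first [done | lia].

Definition incr x := Set_ x (Add (Reg x) (Const 1)).
Definition offset x := Shl (Reg x) (Reg 10).
Definition next p i := Get 5 (Add (Reg p) (Add (Reg i) (Const 1))).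
Definition scaled_entry i k :=
  Shr (Get 3 (Reg i)) (Sub (Get 4 (Reg k)) (Get 4 (Reg i))).

Definition merge_init :=
  Set_ 20 (offset 17) ;; Set_ 21 (Shl (Add (Reg 17) (Const 1)) (Reg 10)) ;;
  Set_ 22 (offset 14) ;; Set_ 23 (Const 0) ;; Set_ 24 (Const 0) ;;
  Set_ 25 (Const 0) ;; Set_ 26 (Const 0).

Definition all_entries := Leq (Reg 25) (Reg 9).

Definition merge_body :=
  If (And (Leq (Reg 26) (Reg 4))
          (Not (Leq (Get 3 (Reg 25))
                    (Add (scaled_entry 23 25) (scaled_entry 24 25)))))
     (If (Leq (next 20 23) (next 21 24))
         (Set_ 26 (next 20 23) ;; incr 23)
         (Set_ 26 (next 21 24) ;; incr 24))
     (Put 5 (Add (Reg 22) (Reg 25)) (Reg 26) ;; incr 25).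

Definition merge_items := merge_init ;; While all_entries merge_body.

Definition copy_init :=
  Set_ 20 (Shl (Get 6 (Get 1 (Reg 16))) (Reg 10)) ;; Set_ 22 (offset 14) ;;
  Set_ 27 (Get 2 (Reg 16)) ;; Put 5 (Reg 22) (Const 0) ;; Set_ 25 (Const 1).

Definition copy_body :=
  Set_ 26 (Add (Get 5 (Add (Reg 20) (Reg 25))) (Reg 27)) ;;
  If (Leq (Reg 26) (Reg 4)) Skip (Set_ 26 (Add (Reg 4) (Const 1))) ;;
  Put 5 (Add (Reg 22) (Reg 25)) (Reg 26) ;; incr 25.

Definition copy_item := copy_init ;; While all_entries copy_body.

Definition arcs_left := Leq (Add (Reg 16) (Const 1)) (Reg 1).
Definition from_vertex := Eq (Get 0 (Reg 16)) (Reg 13).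
Definition head_status := Get 6 (Get 1 (Reg 16)).

Definition check_init := Set_ 15 (Const 1) ;; Set_ 16 (Const 0).
Definition check_body :=
  If (And from_vertex (Eq head_status (Const 0))) (Set_ 15 (Const 0)) Skip ;;
  incr 16.
Definition check_ready := check_init ;; While arcs_left check_body.

Definition gather_init := Set_ 17 (Reg 14) ;; Set_ 16 (Const 0).
(** The other arcs out of the vertex carry no paths. Leaving out those heavier than C also keeps
    unbounded weights away from additions. *)
Definition useful_arc :=
  And from_vertex
    (And (Leq (Const 2) head_status) (Leq (Get 2 (Reg 16)) (Reg 4))).
Definition gather_body :=
  If useful_arc (copy_item ;; incr 14) Skip ;; incr 16.
Definition gather := gather_init ;; While arcs_left gather_body.

Definition two_queued := Leq (Add (Reg 17) (Const 2)) (Reg 14).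
Definition combine_step := Set_ 17 (Add (Reg 17) (Const 2)) ;; incr 14.
Definition combine := While two_queued (merge_items ;; combine_step).

Definition no_item := Eq (Reg 17) (Reg 14).
Definition process :=
  check_ready ;;
  If (Eq (Reg 15) (Const 1))
     (gather ;;
      If no_item (Put 6 (Reg 13) (Const 1))
         (combine ;; Put 6 (Reg 13) (Reg 17)))
     Skip.

Definition rounds_init := Set_ 12 (Const 0) ;; Set_ 13 (Const 0).
Definition rounds_left := Leq (Add (Reg 12) (Const 1)) (Reg 0).
Definition unprocessed := Eq (Get 6 (Reg 13)) (Const 0).
Definition next_vertex :=
  incr 13 ;; If (Eq (Reg 13) (Reg 0)) (Set_ 13 (Const 0) ;; incr 12) Skip.
Definition rounds_body := If unprocessed process Skip ;; next_vertex.
Definition rounds := rounds_init ;; While rounds_left rounds_body.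

Definition output_init := Set_ 20 (Shl (Get 6 (Reg 2)) (Reg 10)) ;; Set_ 25 (Const 0).
Definition passed := Leq (next 20 25) (Reg 4).
Definition decode := Shl (Get 3 (Reg 25)) (Get 4 (Reg 25)).
Definition has_list := Leq (Const 2) (Get 6 (Reg 2)).
Definition output :=
  If has_list
     (output_init ;; While passed (incr 25) ;; Set_ out_reg decode)
     (Set_ out_reg (Const 0)).

Definition below x bound := Leq (Add (Reg x) (Const 1)) bound.

Definition multiply_init y := Set_ y (Const 0) ;; Set_ 12 (Const 0).
Definition multiply_body y step := Set_ y (Add (Reg y) step) ;; incr 12.
(** Repeated addition replaces multiplication. In [parameters] the counters run to n, n (3 + Q) and
    n + 2, so the number of additions does not depend on E. *)
Definition multiply y bound step :=
  multiply_init y ;; While (below 12 bound) (multiply_body y step).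

Definition double_init y start k := Set_ 11 start ;; Set_ y (Const k).
Definition double_body y := Set_ 11 (Add (Reg 11) (Reg 11)) ;; incr y.
Definition double y start k bound :=
  double_init y start k ;; While (below 11 bound) (double_body y).

(* The number of paths to the target becomes the number of paths to the
   additional vertex [n], for which the list of thresholds is immediate. *)
Definition add_arc := Put 0 (Reg 1) (Reg 3) ;; Put 1 (Reg 1) (Reg 0) ;; incr 1.

(** The stride of the lists is the least power of two above K, so that addresses of lists are
    obtained by shifts. *)
Definition parameters :=
  double 6 (Reg 0) 3 (Reg 1) ;;
  multiply 7 (Reg 0) (Reg 6) ;;
  multiply 8 (Reg 7) (Add (Reg 5) (Reg 5)) ;;
  multiply 9 (Add (Reg 0) (Const 2)) (Reg 8) ;;
  double 10 (Const 1) 0 (Add (Reg 9) (Const 1)).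

Definition grid_init :=
  Set_ 20 (Shl (Const 2) (Reg 10)) ;; Set_ 25 (Const 0) ;; Set_ 26 (Const 0) ;;
  Set_ 27 (Const 0).

Definition grid_body :=
  Put 3 (Reg 25) (Reg 26) ;; Put 4 (Reg 25) (Reg 27) ;;
  Put 5 (Add (Reg 20) (Reg 25)) (Add (Reg 4) (Const 1)) ;; incr 26 ;;
  If (Eq (Reg 26) (Add (Reg 8) (Reg 8))) (Set_ 26 (Reg 8) ;; incr 27) Skip ;;
  incr 25.

(** Only the empty path starts at the additional vertex, so its count is 1 and is represented
    exactly: G 0 and G 1 are reached at capacity 0, later values not up to C. Item numbers start at
    2, as 0 and 1 are taken by the other statuses. *)
Definition last_list :=
  Put 5 (Reg 20) (Const 0) ;; Put 5 (Add (Reg 20) (Const 1)) (Const 0) ;;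
  Put 6 (Reg 0) (Const 2) ;; Set_ 14 (Const 3).

Definition setup :=
  add_arc ;; parameters ;; grid_init ;; While all_entries grid_body ;; last_list.

Definition approx_count := setup ;; rounds ;; output.

(** * Processing the vertices *)

Lemma sum_pred1 n v : v < n -> \sum_(0 <= w < n) (w == v) = 1.
Proof.
elim: n => // n IH; rewrite ltnS leq_eqVlt big_nat_recr //=.
case/orP => [/eqP->|h]; last by rewrite IH // gtn_eqF.
rewrite eqxx big1_seq // => w; rewrite mem_index_iota => /andP[_ /andP[_ h]].
by rewrite ltn_eqF.
Qed.

(* A vertex of degree [d] deepens the lists by at most [log2 d + 1]; the bound
   [log2 x <= x] at [x = d / 2 ^ Q] makes the sum over all vertices linear. *)
Lemma depth_bound rho d Q : 2 ^ rho <= (d + d).+1 ->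
  rho * 2 ^ Q <= Q.+1 * 2 ^ Q + d.
Proof.
move=> h; case: (leqP rho Q.+1) => hr.
  by apply: leq_trans (leq_addr _ _); rewrite leq_mul2r hr orbT.
have [x hx] : exists x, rho = Q.+1 + x by exists (rho - Q.+1); lia.
have hx0 : 0 < x by lia.
rewrite hx mulnDl leq_add2l.
have : x * 2 ^ Q <= 2 ^ (Q + x).
  by rewrite mulnC expnD leq_mul2l ltnW ?orbT // ltn_expl.
move: h; rewrite hx addSn expnS mul2n -addnn.
by case: (2 ^ (Q + x)) => [|y]; lia.
Qed.

(** The phases that build lists use a range of scratch registers and write lists into fresh cells
    only, so two bounds describe all that they may disturb. *)
Record frame (d z : nat) (sg sg' : state) : Prop := Frame {
  frame_reg : forall x, x < d -> reg sg' x = reg sg x;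
  frame_mem : forall a, a != 5 -> mem sg' a = mem sg a;
  frame_items : forall i, i < z -> mem sg' 5 i = mem sg 5 i }.

Lemma frame_trans d z sg1 sg2 sg3 :
  frame d z sg1 sg2 -> frame d z sg2 sg3 -> frame d z sg1 sg3.
Proof.
case=> h1 h2 h3 [k1 k2 k3]; split.
- by move=> x hx; rewrite k1 ?h1.
- by move=> x hx; rewrite k2 ?h2.
- by move=> x hx; rewrite k3 ?h3.
Qed.

Lemma frame_weaken d z d' z' sg sg' :
  d' <= d -> z' <= z -> frame d z sg sg' -> frame d' z' sg sg'.
Proof.
move=> hd hz [h1 h2 h3]; split=> // x hx.
  by apply: h1; apply: leq_trans hd.
by apply: h3; apply: leq_trans hz.
Qed.

Lemma frame_set d z x v sg sg' :
  d <= x -> frame d z sg sg' -> frame d z sg (set_reg x v sg').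
Proof.
move=> hx [h1 h2 h3]; split=> //= y hy; rewrite /upd ifN ?h1 //.
by rewrite neq_ltn (leq_trans hy).
Qed.

Lemma frame_put d z i v sg sg' :
  z <= i -> frame d z sg sg' -> frame d z sg (set_mem 5 i v sg').
Proof.
move=> hx [h1 h2 h3]; split=> //=.
  by move=> a ha; rewrite /upd ifN ?h2.
by move=> y hy; rewrite /upd /= ifN ?h3 // neq_ltn (leq_trans hy).
Qed.

Record sizes (n m C M K b S X Y l L U : nat) : Prop := Sizes {
  sz_short_unit : words l (nbits X + nbits X) <= U;
  sz_long_unit : words L (nbits Y + nbits Y) <= U;
  sz_M_gt1 : 1 < M;
  sz_K_def : K = n.+2 * M;
  sz_S_def : 2 ^ b = S;
  sz_K_lt_S : K < S;
  sz_X_b : b <= X;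
  sz_X_K : K < X;
  sz_X_M : M + M <= X;
  sz_X_n : n.+2 < X;
  sz_X_m : m < X;
  sz_X_items : (m + m + 4) * S <= X;
  sz_X_le_Y : X <= Y;
  sz_C_le_Y : C.+1 + C.+1 <= Y }.

Section Run.

Variables (n m C M K b S X Y l L U : nat) (tl hd wt : nat -> nat).
Hypothesis hsz : sizes n m C M K b S X Y l L U.

Let short_unit : words l (nbits X + nbits X) <= U.
Proof. by case: hsz. Qed.
Let long_unit : words L (nbits Y + nbits Y) <= U.
Proof. by case: hsz. Qed.
Let M_gt1 : 1 < M.
Proof. by case: hsz. Qed.
Let K_def : K = n.+2 * M.
Proof. by case: hsz. Qed.
Let S_def : 2 ^ b = S.
Proof. by case: hsz. Qed.
Let K_lt_S : K < S.
Proof. by case: hsz. Qed.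
Let X_b : b <= X.
Proof. by case: hsz. Qed.
Let X_K : K < X.
Proof. by case: hsz. Qed.
Let X_M : M + M <= X.
Proof. by case: hsz. Qed.
Let X_n : n.+2 < X.
Proof. by case: hsz. Qed.
Let X_m : m < X.
Proof. by case: hsz. Qed.
Let X_items : (m + m + 4) * S <= X.
Proof. by case: hsz. Qed.
Let X_le_Y : X <= Y.
Proof. by case: hsz. Qed.
Let C_le_Y : C.+1 + C.+1 <= Y.
Proof. by case: hsz. Qed.

Let G := gval M.

Let K_gt0 : 0 < K.
Proof. by rewrite K_def muln_gt0 (ltnW M_gt1). Qed.

Record env (sg : state) : Prop := Env {
  env_n : reg sg 0 = n;
  env_m : reg sg 1 = m;
  env_C : reg sg 4 = C;
  env_K : reg sg 9 = K;
  env_b : reg sg 10 = b;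
  env_tl : forall a, a < m -> mem sg 0 a = tl a;
  env_hd : forall a, a < m -> mem sg 1 a = hd a;
  env_wt : forall a, a < m -> mem sg 2 a = wt a;
  env_mant : forall k, k <= K -> mem sg 3 k = mant M k;
  env_expo : forall k, k <= K -> mem sg 4 k = expo M k }.

Lemma env_frame d z sg sg' : 10 < d -> frame d z sg sg' -> env sg -> env sg'.
Proof.
move=> hd' [h1 h2 h3] [e0 e1 e2 e3 e4 e5 e6 e7 e8 e9].
by split; rewrite ?h2 // h1 // (leq_trans _ hd').
Qed.

(** * Merging and copying lists in memory *)

Definition item (sg : state) (z k : nat) : nat := mem sg 5 (z * S + k).

Let approx := approx M K C.

Lemma item_frame d z z' sg sg' k : z' < z -> k <= K ->
  frame d (z * S) sg sg' -> item sg' z' k = item sg z' k.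
Proof.
move=> hz hk [_ _ h]; rewrite /item h // (@leq_trans (z'.+1 * S)) //.
  by rewrite mulSn; lia.
by rewrite leq_mul2r hz orbT.
Qed.

Lemma approx_frame d z z' sg sg' F r : z' < z -> frame d (z * S) sg sg' ->
  approx (item sg z') F r -> approx (item sg' z') F r.
Proof.
move=> hz hf; apply: approx_eq => // k hk.
by rewrite (item_frame hz hk hf).
Qed.

Lemma grid_bounds k : k <= K -> mant M k <= X /\ expo M k <= X.
Proof.
move=> hk; have [_ h _] := grid_spec M_gt1 k.
have := @expo_le M M_gt1 n k; rewrite -K_def => /(_ hk); lia.
Qed.

(** Every iteration advances exactly one of the three indices [i], [j] and [k], and none of them
    exceeds K + 1. *)
Definition merge_time :=
  csize merge_init * U
  + ((K.+1 + K.+1 + K.+1) * (csize merge_body * U + tsize all_entries * U)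
     + tsize all_entries * U).

Lemma wp_merge sg F1 F2 r :
  env sg -> (reg sg 17).+1 < reg sg 14 -> (reg sg 14).+1 * S <= X ->
  approx (item sg (reg sg 17)) F1 r -> approx (item sg (reg sg 17).+1) F2 r ->
  (forall c, c <= C -> F1 c + F2 c < G K) ->
  wp l L merge_items sg merge_time (fun sg' =>
    frame 20 (reg sg 14 * S) sg sg' /\
    approx (item sg' (reg sg 14)) (fun c => F1 c + F2 c) r.+1).
Proof.
set lo := reg sg 17; set hi := reg sg 14 => env0 hlo hhi hA hB hG.
have hlo1 : lo.+2 * S <= hi * S by rewrite leq_mul2r hlo orbT.
have hlo2 : hi * S + S <= X by move: hhi; rewrite mulSn addnC.
rewrite !mulSn in hlo1.
have hlo0 : lo <= lo * S by rewrite leq_pmulr; lia.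
apply: wp_seq; apply: (wp_straight short_unit long_unit).
  case: (env0) => e0 e1 e2 e3 e4 _ _ _ _ _.
  rewrite /= /upd /= e4 -/lo -/hi S_def; safety.
rewrite /= /upd /= (env_b env0) -/lo -/hi S_def.
pose A := item sg lo; pose B := item sg lo.+1.
have AK : A K = C.+1 := approx_last hA.
have BK : B K = C.+1 := approx_last hB.
pose I s sg' := exists i j k cur,
  [/\ s = i + j + k, merging M K C A B i j k cur (item sg' hi),
      frame 20 (hi * S) sg sg' & 
      [/\ reg sg' 23 = i, reg sg' 24 = j, reg sg' 25 = k & reg sg' 26 = cur]
      /\ [/\ reg sg' 20 = lo * S, reg sg' 21 = lo.+1 * S, reg sg' 22 = hi * S
      & k <= K.+1]].
apply: (@wp_while _ _ _ _ _ short_unit long_unit _ _ _ _ I); last first.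
  exists 0, 0, 0, 0; split=> //.
  - exact: (merging_init hA hB).
  - by do ![apply: frame_set => //].
  - by rewrite /= /upd /= addn1.
move=> _ {}sg' [i [j [k [cur [-> hm hf [[r23 r24 r25 r26] [r20 r21 r22 hk]]]]]]].
have env1 := env_frame (isT : 10 < 20) hf env0.
have [e0 e1 e2 e3 e4 _ _ _ e8 e9] := env1.
split.
  by rewrite /= r25 e3; split=> //; lia.
have [hi1 hi2 hi3 hi4] := mg_i hm.
have [hj1 hj2 hj3 hj4] := mg_j hm.
have hcur := mg_cur hm.
rewrite /= r25 e3; case: (leqP k K) => hkK; last first.
  split; first lia.
  have hk' : k = K.+1 by lia.
  by split=> //; apply: (merging_final M_gt1 K_gt0 hA hB) hG; rewrite -hk'; exact: hm.
split; first lia.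
have [bi1 bi2] := grid_bounds hi2.
have [bj1 bj2] := grid_bounds hj2.
have [bk1 bk2] := grid_bounds hkK.
have div1 : mant M i %/ 2 ^ (expo M k - expo M i) <= X.
  exact: leq_trans (leq_div _ _) bi1.
have div2 : mant M j %/ 2 ^ (expo M k - expo M j) <= X.
  exact: leq_trans (leq_div _ _) bj1.
have nextA : i < K -> mem sg' 5 (lo * S + (i + 1)) = A i.+1.
  by move=> h; rewrite addn1; apply: (item_frame _ h hf); exact: ltnW.
have nextB : j < K -> mem sg' 5 (lo.+1 * S + (j + 1)) = B j.+1.
  by move=> h; rewrite addn1; apply: (item_frame _ h hf).
(* Up to capacity C a pointer cannot be at entry K, whose threshold is C + 1; so the next entry
   exists whenever it is read. *)
have lastA : A i <= C -> i < K.
  move=> h; rewrite ltn_neqAle hi2 andbT; apply/eqP => h'.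
  by move: h; rewrite h' AK ltnn.
have lastB : B j <= C -> j < K.
  move=> h; rewrite ltn_neqAle hj2 andbT; apply/eqP => h'.
  by move: h; rewrite h' BK ltnn.
have boundA : i < K -> A i.+1 <= C.+1 by exact: (approx_le_last hA).
have boundB : j < K -> B j.+1 <= C.+1 by exact: (approx_le_last hB).
apply: (wp_straight short_unit long_unit).
  rewrite /= r20 r21 r22 r23 r24 r25 r26 e2 !e8 // !e9 //.
  move: (_ %/ _) (_ %/ _) div1 div2 => d1 d2 div1 div2.
  split; first by safety.
  case: ifP => [/andP[h1 h2]|_]; last first.
    by rewrite /= /upd /= ?r25; safety.
  have iK := lastA (leq_trans hi3 h1); have jK := lastB (leq_trans hj3 h1).
  move: (boundA iK) (boundB jK) => bA bB.
  rewrite ?nextA // ?nextB // /= ?r20 ?r21 ?r22 ?r23 ?r24 ?r25 ?r26 mulSn.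
  split; first by safety.
  by case: ifP => _ /=; rewrite ?nextA // ?nextB // /upd /= ?r23 ?r24; safety.
clear div1 div2; rewrite /= r20 r21 r22 r23 r24 r25 r26 e2 !e8 // !e9 // -/(emit M i j k).
case: ifP => [/andP[h1 h2]|/negbT]; last first.
  rewrite negb_and negbK -ltnNge => he.
  rewrite /= /upd /= ?r25; exists i, j, k.+1, cur; split.
  - lia.
  - apply: (merging_emit M_gt1 K_gt0 hm he); rewrite /item /= /upd /=; first by rewrite eqxx.
    by move=> k' hk'; rewrite eqn_add2l ltn_eqF.
  - by apply: frame_set => //; apply: frame_put => //; lia.
  - by rewrite /= /upd /= addn1.
have iK := lastA (leq_trans hi3 h1); have jK := lastB (leq_trans hj3 h1).
rewrite nextA // nextB //; case: (leqP (A i.+1) (B j.+1)) => hAB.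
  rewrite /= ?r20 ?r23 ?nextA // /upd /= ?r23.
  have [_ hm'] := merging_advance M_gt1 K_gt0 hA hB hm h1 h2 jK hAB.
  exists i.+1, j, k, (A i.+1); split=> //.
  - by do ![apply: frame_set => //].
  - by rewrite /= /upd /= addn1.
rewrite /= ?r21 ?r24 ?nextB // /upd /= ?r24.
rewrite emitC in h2.
have [_ hm'] := merging_advance M_gt1 K_gt0 hB hA (merging_sym hm) h1 h2 iK (ltnW hAB).
exists i, j.+1, k, (B j.+1); split=> //; first lia.
- exact: merging_sym.
- by do ![apply: frame_set => //].
- by rewrite /= /upd /= addn1.
Qed.

Definition copy_time :=
  csize copy_init * U
  + (K * (csize copy_body * U + tsize all_entries * U) + tsize all_entries * U).

Lemma wp_copy sg F r a z :
  env sg -> reg sg 16 = a -> a < m -> hd a <= X -> wt a <= C ->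
  mem sg 6 (hd a) = z -> z < reg sg 14 -> (reg sg 14).+1 * S <= X ->
  approx (item sg z) F r ->
  wp l L copy_item sg copy_time (fun sg' =>
    frame 20 (reg sg 14 * S) sg sg' /\
    approx (item sg' (reg sg 14))
      (fun c => if wt a <= c then F (c - wt a) else 0) r).
Proof.
set hi := reg sg 14 => env0 ra am hu hw hz zhi hhi hA.
have hz1 : z.+1 * S <= hi * S by rewrite leq_mul2r zhi orbT.
have hhi2 : hi * S + S <= X by move: hhi; rewrite mulSn addnC.
have hhi0 : hi <= hi * S by rewrite leq_pmulr; lia.
rewrite mulSn in hz1.
have zX : z <= X by lia.
have [_ _ _ _ e4 _ e6 e7 _ _] := env0.
apply: wp_seq; apply: (wp_straight short_unit long_unit).
  rewrite /= /upd /= ra e4 e6 // e7 // hz -/hi S_def; safety.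
rewrite /= /upd /= ra e4 e6 // e7 // hz -/hi S_def.
pose A := item sg z.
have boundA k : k <= K -> A k <= C.+1 by exact: (approx_le_last hA).
pose I s sg' := [/\ s <= K, reg sg' 25 = s.+1, frame 20 (hi * S) sg sg',
      [/\ reg sg' 20 = z * S, reg sg' 22 = hi * S & reg sg' 27 = wt a] &
      item sg' hi 0 = 0 /\ forall k, 0 < k -> k <= s ->
        item sg' hi k = minn (A k + wt a) C.+1].
apply: (@wp_while _ _ _ _ _ short_unit long_unit _ _ _ _ I); last first.
  split=> //.
  - by do ![apply: frame_set => //]; apply: frame_put => //; do ![apply: frame_set => //].
  - by rewrite /item /= /upd /= addn0 eqxx; split=> // k; lia.
move=> s {}sg' [hs r25 hf [r20 r22 r27] [h0 hk]].
have env1 := env_frame (isT : 10 < 20) hf env0.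
have [_ _ e2 e3 _ _ _ _ _ _] := env1.
rewrite /= r25 e3; split; first by safety.
case: (ltnP s K) => hsK; last first.
  split=> //; split=> //; apply: (approx_shift M_gt1 K_gt0 hA hw h0) => k h1 h2.
  by apply: hk => //; apply: leq_trans hsK.
split=> //.
have itemA : mem sg' 5 (z * S + s.+1) = A s.+1 by apply: (item_frame zhi hsK hf).
have := boundA _ hsK => bA.
apply: (wp_straight short_unit long_unit).
  rewrite /= /upd /= ?r20 ?r22 ?r25 ?r27 ?e2 ?itemA.
  split; first by safety.
  split; first by split; [safety | case: ifP => _ /=; rewrite ?e2; safety].
  by case: ifP => h /=; rewrite /upd /= ?r20 ?r22 ?r25 ?r27 ?e2; safety.
have itemE v : forall k, k <= s ->
    (if hi * S + k == hi * S + s.+1 then v else mem sg' 5 (hi * S + k))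
    = item sg' hi k.
  by move=> k hks; rewrite eqn_add2l ltn_eqF.
rewrite /= /upd /= ?r20 ?r25 ?r27 ?e2 ?itemA.
case: ifP => hc /=; rewrite /upd /= ?r22 ?r25 ?e2; split=> //=;
  rewrite /= /upd /= ?addn1 //.
- by do ![apply: frame_set => //]; apply: frame_put; [lia|]; do ![apply: frame_set => //].
- split; first by rewrite /item /= /upd /= itemE.
  move=> k hk1; rewrite leq_eqVlt /item /= /upd /= => /orP[/eqP->|hk2].
    by rewrite eqxx; lia.
  by rewrite [LHS]itemE // hk.
- by do ![apply: frame_set => //]; apply: frame_put; [lia|]; do ![apply: frame_set => //].
- split; first by rewrite /item /= /upd /= itemE.
  move=> k hk1; rewrite leq_eqVlt /item /= /upd /= => /orP[/eqP->|hk2].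
    by rewrite eqxx; lia.
  by rewrite [LHS]itemE // hk.
Qed.

(** * The list of a single vertex *)

Variable F : nat -> nat -> nat.
Definition arc_paths a c := if wt a <= c then F (hd a) (c - wt a) else 0.
Definition paths_upto (v a c : nat) := \sum_(0 <= a' < a | tl a' == v) arc_paths a' c.
Hypothesis F_rec : forall v c, v < n -> c <= C -> F v c = paths_upto v m c.
Hypothesis F_bound : forall v c, v < n -> c <= C -> F v c < gval M K.
Hypothesis tl_lt : forall a, a < m -> tl a < n.
Hypothesis hd_le : forall a, a < m -> hd a <= n.

Definition status (sg : state) (v : nat) := mem sg 6 v.
Definition deg_upto (v a : nat) := \sum_(0 <= a' < a) (tl a' == v).
Definition deg (v : nat) := deg_upto v m.
(** The common potential for space, time and error: whatever processing a vertex consumes in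
    proportion to its degree is paid by the decrease of this number. *)
Definition arcs_todo sg := \sum_(0 <= a < m) (status sg (tl a) == 0).

Definition ready_upto sg (v a : nat) :=
  all (fun a' => (tl a' == v) ==> (status sg (hd a') != 0)) (iota 0 a).

Lemma ready_uptoS sg v a : ready_upto sg v a.+1 =
  ready_upto sg v a && ((tl a == v) ==> (status sg (hd a) != 0)).
Proof. by rewrite /ready_upto -addn1 iotaD all_cat /= andbT. Qed.

(** Each arc still to come may create two items, its shifted copy and the result of a merge; hence
    the form of [inv_top], where 3 is the first free item after the setup. *)
Record inv (r : nat) (sg : state) : Prop := Inv {
  inv_env : env sg;
  inv_gt1 : 1 < reg sg 14;
  inv_top : reg sg 14 + (arcs_todo sg + arcs_todo sg) <= m + m + 3;
  inv_status : forall v, v <= n -> status sg v < reg sg 14;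
  inv_dead : forall v c, v <= n -> status sg v = 1 -> c <= C -> F v c = 0;
  inv_live : forall v, v <= n -> 1 < status sg v ->
    approx (item sg (status sg v)) (F v) r }.

Lemma top_bound sg r : inv r sg -> reg sg 14 <= X.
Proof.
move=> h; have := inv_top h; move: X_items; rewrite mulnDl => h1 h2.
have : m + m <= (m + m) * S by rewrite leq_pmulr; lia.
lia.
Qed.

Definition check_time :=
  csize check_init * U
  + (m * (csize check_body * U + tsize arcs_left * U) + tsize arcs_left * U).

Lemma wp_check sg r : inv r sg ->
  wp l L check_ready sg check_time (fun sg' =>
    frame 15 (reg sg 14 * S) sg sg' /\
    reg sg' 15 = ready_upto sg (reg sg 13) m).
Proof.
set v := reg sg 13 => hinv; have env0 := inv_env hinv; have hX := top_bound hinv.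
apply: wp_seq; apply: (wp_straight short_unit long_unit).
  by rewrite /=; safety.
pose I a sg' := [/\ a <= m, reg sg' 16 = a,
  reg sg' 15 = ready_upto sg v a & frame 15 (reg sg 14 * S) sg sg'].
apply: (@wp_while _ _ _ _ _ short_unit long_unit _ _ _ _ I); last first.
  by split=> //; do ![apply: frame_set => //].
move=> a sg' [ha r16 r15 hf].
have env1 := env_frame (isT : 10 < 15) hf env0.
have [e0 e1 e2 e3 e4 e5 e6 _ _ _] := env1.
rewrite /= r16 e1 addn1; split; first by safety.
case: (ltnP a m) => ham; last first.
  by split=> //; split=> //; rewrite r15; have -> : m = a by lia.
split=> //; have h6 : mem sg' 6 = mem sg 6 by rewrite (frame_mem hf).
have r13 : reg sg' 13 = v by rewrite (frame_reg hf).
have hhd := hd_le ham; have htl := tl_lt ham.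
apply: (wp_straight short_unit long_unit).
  rewrite /= r16 e5 // e6 // h6 r13; split.
    by split; [safety | case: ifP].
  by case: ifP => _ /=; rewrite /upd /= ?r16; safety.
rewrite /= r16 e5 // e6 // h6 r13; case: ifP => hc; rewrite /= /upd /= r16 addn1;
  split=> //=; rewrite /upd /= ?r15 ?ready_uptoS; try by do ![apply: frame_set => //].
- by case/andP: hc => -> /eqP h; rewrite /status h andbF.
- by move: hc; rewrite /status; case: (tl a == v) => /= [h|_]; rewrite ?h andbT.
Qed.

Lemma deg_uptoS v a : deg_upto v a.+1 = deg_upto v a + (tl a == v).
Proof. by rewrite /deg_upto big_nat_recr. Qed.

Lemma deg_upto_mono v a : a <= m -> deg_upto v a <= deg v.
Proof.
move=> h; rewrite /deg /deg_upto (big_cat_nat (leq0n a) h) /=.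
exact: leq_addr.
Qed.

Lemma deg_le_todo sg v : status sg v = 0 -> deg v <= arcs_todo sg.
Proof.
move=> h; apply: leq_sum => a _.
by case: eqP => // ->; rewrite h.
Qed.

Lemma paths_uptoS v a c : paths_upto v a.+1 c =
  paths_upto v a c + (if tl a == v then arc_paths a c else 0).
Proof. by rewrite /paths_upto big_mkcond big_nat_recr //= -big_mkcond. Qed.

Definition copy_budget := copy_time + csize (incr 14) * U.
(** All arcs are scanned, whatever the vertex; the expensive copies are charged separately to the
    arcs that leave it. *)
Definition gather_arc_time :=
  tsize useful_arc * U + U + csize (incr 16) * U + tsize arcs_left * U.
Definition gather_time (v : nat) :=
  csize gather_init * U
  + (m * gather_arc_time + deg v * copy_budget + tsize arcs_left * U).

Lemma wp_gather sg r v :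
  inv r sg -> reg sg 13 = v -> v < n -> status sg v = 0 ->
  (forall a, a < m -> tl a = v -> status sg (hd a) != 0) ->
  wp l L gather sg (gather_time v) (fun sg' => exists q Phi,
    [/\ frame 14 (reg sg 14 * S) sg sg', reg sg' 17 = reg sg 14,
        reg sg' 14 = reg sg 14 + q /\ q <= deg v,
        forall j, reg sg 14 <= j < reg sg 14 + q ->
          approx (item sg' j) (Phi j) r &
        forall c, c <= C ->
          \sum_(reg sg 14 <= j < reg sg 14 + q) Phi j c = paths_upto v m c]).
Proof.
set base := reg sg 14 => hinv rv hv sv hready.
have env0 := inv_env hinv; have hX := top_bound hinv.
have htop := inv_top hinv; have hdeg := deg_le_todo sv.
apply: wp_seq; apply: (wp_straight short_unit long_unit).
  by rewrite /=; safety.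
rewrite /= -/base; set sg0 := set_reg _ _ _.
pose I i sg' := exists a q (Phi : nat -> nat -> nat),
  [/\ i = a * gather_arc_time + deg_upto v a * copy_budget, 
      a <= m /\ q <= deg_upto v a,
      [/\ frame 14 (base * S) sg sg', reg sg' 16 = a, reg sg' 17 = base &
          reg sg' 14 = base + q],
      forall j, base <= j < base + q -> approx (item sg' j) (Phi j) r &
      forall c, c <= C ->
        \sum_(base <= j < base + q) Phi j c = paths_upto v a c].
apply: (@wp_while_budget _ _ _ _ _ short_unit long_unit _ _ _ I); last first.
  exists 0, 0, (fun _ _ => 0); split=> //.
  - by rewrite /deg_upto big_nil.
  - split=> //; first by do ![apply: frame_set => //].
    by rewrite /= addn0.
  - by move=> j; lia.
  - by move=> c _; rewrite addn0 big_geq // /paths_upto big_nil.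
move=> i sg' [a [q [Phi [-> [ha hq] [hf r16 r17 r14] hPhi hsum]]]].
have env1 := env_frame (isT : 10 < 14) hf env0.
have [e0 e1 e2 e3 e4 e5 e6 e7 _ _] := env1.
rewrite /= r16 e1 addn1; split; first by safety.
  by rewrite leq_add2r leq_add // leq_mul2r ?ha ?deg_upto_mono ?orbT.
case: (ltnP a m) => ham; last first.
  have am : a = m by lia.
  by rewrite am in hq hsum; exists q, Phi; split.
have h6 : mem sg' 6 = mem sg 6 by rewrite (frame_mem hf).
have r13 : reg sg' 13 = v by rewrite (frame_reg hf).
have hhd := hd_le ham; have htl := tl_lt ham.
have hst := inv_status hinv hhd.
pose t := tsize useful_arc * U +
  (if tl a == v then copy_budget else U) + csize (incr 16) * U.
exists t.
have ht : a * gather_arc_time + deg_upto v a * copy_budget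
    + tsize arcs_left * U + t
    <= a.+1 * gather_arc_time + deg_upto v a.+1 * copy_budget.
  rewrite deg_uptoS /t mulSn (mulnDl _ _ copy_budget); move: (a * _) => x.
  move: (deg_upto v a * _) => y; rewrite /gather_arc_time; move: (_ * U) (_ * U) (_ * U) => p1 p2 p3.
  by case: eqP => _; rewrite ?mul1n ?mul0n; lia.
suff Hif : wp l L (If useful_arc (copy_item ;; incr 14) Skip) sg'
    (tsize useful_arc * U + (if tl a == v then copy_budget else U))
    (fun sg2 => exists q' Phi', [/\ q' <= deg_upto v a.+1,
      [/\ frame 14 (base * S) sg sg2, reg sg2 16 = a, reg sg2 17 = base &
          reg sg2 14 = base + q'],
      forall j, base <= j < base + q' -> approx (item sg2 j) (Phi' j) r &
      forall c, c <= C ->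
        \sum_(base <= j < base + q') Phi' j c = paths_upto v a.+1 c]).
  apply: wp_seq; apply: wp_weaken Hif (leqnn _) _.
  move=> sg2 [q' [Phi' [hq' [hf2 s16 s17 s14] hPhi' hsum']]].
  apply: (wp_straight short_unit long_unit).
    by rewrite /= s16; safety.
  exists (a.+1 * gather_arc_time + deg_upto v a.+1 * copy_budget) => //.
  exists a.+1, q', Phi'; split=> //.
  by split=> //=; rewrite /upd /= ?s16 ?addn1 //; apply: frame_set.
have holdsE : holds sg' useful_arc =
    [&& tl a == v, 1 < status sg (hd a) & wt a <= C].
  by rewrite /= r16 e5 // e6 // e7 // h6 r13 e2.
apply: (wp_if short_unit long_unit).
  by rewrite /= r16 e5 // e6 // e7 // h6 r13 e2 -/(status sg _); safety.
rewrite holdsE; case: ifP => [/and3P[/eqP hta hlive hw]|huse]; last first.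
  have U_gt0 : 0 < U by exact: leq_trans short_unit.
  exists 1, sg'; split; first exact: exec_skip.
    by case: ifP => // _; rewrite addn_gt0 muln_gt0 U_gt0 orbT.
  exists q, Phi; split=> //; first by rewrite deg_uptoS (leq_trans hq) ?leq_addr.
  (* A skipped arc contributes nothing: it does not leave [v], or it is heavier than [c], or its
     head, which is processed as [v] is ready, is dead. *)
  move=> c hc; rewrite paths_uptoS hsum //; case: eqP huse => [hta|_]; last by rewrite addn0.
  rewrite /= /arc_paths; case: (leqP (wt a) c) => hwc; last by rewrite addn0.
  rewrite (leq_trans hwc hc) andbT ltnNge => /negbFE hst1.
  rewrite (inv_dead hinv) ?addn0 //; last lia.
  by have := hready a ham hta; lia.
rewrite hta eqxx.
have hhi : (reg sg' 14).+1 * S <= X.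
  apply: leq_trans X_items; rewrite leq_mul2r r14; apply/orP; right.
  by have := deg_upto_mono v ha; lia.
have hqX : base + q < X by apply: leq_trans hhi; rewrite r14 leq_pmulr; lia.
have hA : approx (item sg' (status sg (hd a))) (F (hd a)) r.
  by apply: (approx_frame hst hf); exact: (inv_live hinv).
apply: wp_seq; apply: wp_weaken.
- apply: (wp_copy env1 r16 ham _ hw _ _ hhi hA); first lia.
    by rewrite h6.
  by rewrite r14; lia.
- exact: leqnn.
move=> sg2 [hf2 hA2]; apply: (wp_straight short_unit long_unit).
  by rewrite /= (frame_reg hf2) // r14; safety.
have hf3 : frame 14 (base * S) sg' sg2.
  apply: frame_weaken hf2 => //.
  by rewrite leq_mul2r r14 leq_addr orbT.
exists q.+1, (upd Phi (base + q) (arc_paths a)); split.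
- by rewrite deg_uptoS hta eqxx addn1.
- split; rewrite /= /upd /= ?(frame_reg hf2) // ?r14 ?addnS ?addn0 ?addn1 //.
  by apply: frame_set => //; apply: frame_trans hf hf3.
- move=> j hj; rewrite /upd; case: eqP => [->|hne].
    by move: hA2; rewrite r14.
  have hjq : base <= j < base + q by lia.
  apply: approx_eq (hPhi j hjq) => // k hk; rewrite r14 in hf2.
  have hj2 : j < base + q by lia.
  by symmetry; apply: (item_frame hj2 hk hf2).
- move=> c hc; rewrite addnS big_nat_recr ?leq_addr //= paths_uptoS hta eqxx -hsum //.
  rewrite {2}/upd eqxx; congr (_ + _).
  by apply: eq_big_nat => j hj; rewrite /upd ifN //; lia.
Qed.

Definition combine_time q :=
  q * (merge_time + csize combine_step * U + tsize two_queued * U)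
  + tsize two_queued * U.

(* An item at distance [j] from [base] stands at depth less than
   [log2 (2 q / (2 q - 1 - j))] of a balanced tree, as item [q + i] is made
   from items [2 i] and [2 i + 1]. *)
Lemma wp_combine sg base q Phi f r :
  env sg -> reg sg 17 = base -> reg sg 14 = base + q -> 0 < q ->
  (base + q + q) * S <= X ->
  (forall j, base <= j < base + q -> approx (item sg j) (Phi j) r) ->
  (forall c, c <= C -> \sum_(base <= j < base + q) Phi j c = f c) ->
  (forall c, c <= C -> f c < gval M K) ->
  wp l L combine sg (combine_time q) (fun sg' => exists rho,
    [/\ frame 14 (base * S) sg sg',
        reg sg' 14 = (reg sg' 17).+1 /\ base <= reg sg' 17,
        reg sg' 14 < base + q + q, 2 ^ rho < q + q &
        approx (item sg' (reg sg' 17)) f (r + rho)]).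
Proof.
move=> env0 r17 r14 hq hX hPhi hsum hf.
pose I i sg' := exists Phi : nat -> nat -> nat,
  [/\ i < q, frame 14 (base * S) sg sg',
      reg sg' 17 = base + (i + i) /\ reg sg' 14 = base + q + i,
      forall j, base + (i + i) <= j < base + q + i -> exists rho,
        2 ^ rho * ((q + q).-1 - (j - base)) < q + q /\
        approx (item sg' j) (Phi j) (r + rho) &
      forall c, c <= C ->
        \sum_(base + (i + i) <= j < base + q + i) Phi j c = f c].
apply: (@wp_while _ _ _ _ _ short_unit long_unit _ _ _ _ I); last first.
  exists Phi; rewrite !addn0; split=> // j hj; exists 0.
  by rewrite addn0 expn0 mul1n; split; [lia | exact: hPhi].
move=> i sg' {hPhi hsum}[{}Phi [hi hfr [s17 s14] hPhi hsum]].
have env1 := env_frame (isT : 10 < 14) hfr env0.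
have hX2 : base + q + q <= X by apply: leq_trans hX; rewrite leq_pmulr; lia.
rewrite /= s17 s14; split; first by safety.
case: (leqP (base + (i + i) + 2) (base + q + i)) => hlo; last first.
  (* One list is left, at distance 2 q - 2 from [base], where the depth estimate reads 2 ^ rho < 2
     q. *)
  have ei : i + i = (q + i).-1 by lia.
  have hj : base + (i + i) <= base + (i + i) < base + q + i by lia.
  have [rho [h1 h2]] := hPhi _ hj.
  split; first exact: ltnW.
  exists rho; split=> //; try lia.
    have e : (q + q).-1 - (base + (i + i) - base) = 1 by lia.
    by rewrite e muln1 in h1.
  apply: approx_eq h2 => // c hc; rewrite -hsum //.
  have -> : base + q + i = (base + (i + i)).+1 by lia.
  by rewrite big_nat1.
split=> //.
set lo := base + (i + i) in hlo s17 hPhi hsum; set hi' := base + q + i in hlo s14 hPhi hsum.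
have hj1 : lo <= lo < hi' by lia.
have hj2 : lo <= lo.+1 < hi' by lia.
have [rho1 [d1 A1]] := hPhi _ hj1.
have [rho2 [d2 A2]] := hPhi _ hj2.
pose rho := maxn rho1 rho2.
have {}A1 := approx_weaken A1 (leq_add (leqnn r) (leq_maxl rho1 rho2)).
have {}A2 := approx_weaken A2 (leq_add (leqnn r) (leq_maxr rho1 rho2)).
have sumE c : \sum_(lo <= j < hi') Phi j c =
    Phi lo c + Phi lo.+1 c + \sum_(lo.+2 <= j < hi') Phi j c.
  by rewrite big_ltn 1?big_ltn ?addnA //; lia.
have hfit : hi'.+1 * S <= X.
  by apply: leq_trans hX; rewrite leq_mul2r; apply/orP; right; lia.
have hsum12 c : c <= C -> Phi lo c + Phi lo.+1 c < gval M K.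
  by move=> hc; apply: leq_ltn_trans (hf c hc); rewrite -hsum // sumE leq_addr.
apply: wp_seq; apply: wp_weaken (leqnn _) _.
  by apply: (wp_merge env1 _ _ _ _ hsum12);
    rewrite ?s17 ?s14 //; [lia | exact: A1 | exact: A2].
rewrite s14 => sg2 [hf2 AR]; apply: (wp_straight short_unit long_unit).
  by rewrite /= /upd /= !(frame_reg hf2) // s17 s14; safety.
have hf3 : frame 14 (base * S) sg' sg2.
  apply: frame_weaken hf2 => //.
  by rewrite leq_mul2r /hi' -addnA leq_addr orbT.
exists (upd Phi hi' (fun c => Phi lo c + Phi lo.+1 c)).
have e1 : base + (i.+1 + i.+1) = lo + 2 by lia.
have e2 : base + q + i.+1 = hi'.+1 by lia.
rewrite e1 e2; split.
- lia.
- by do ![apply: frame_set => //]; apply: frame_trans hfr hf3.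
- by rewrite /= /upd /= !(frame_reg hf2) // s17 s14 addn1.
- move=> j hj; rewrite /upd; case: eqP => [->|hne].
    (* Twice the factor 2 q - 1 - (q + i) is 2 q - 1 - (2 i + 1), the factor of the later child, and
       less than that of the earlier one. So the estimate passes from the deeper child to the
       parent. *)
    exists rho.+1; split; last by rewrite addnS.
    rewrite expnS mulnAC mulnC mulnA -mulnA.
    case: (leqP rho1 rho2) => h.
      have -> : rho = rho2 by apply/maxn_idPr.
      apply: leq_ltn_trans d2; rewrite leq_mul2l; apply/orP; right; lia.
    have -> : rho = rho1 by apply/maxn_idPl/ltnW.
    apply: leq_ltn_trans d1; rewrite leq_mul2l; apply/orP; right; lia.
  have hj' : lo <= j < hi' by lia.
  have [rho' [h1 h2]] := hPhi j hj'; exists rho'; split=> //.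
  apply: approx_eq h2 => // k hk; have hj2' : j < hi' by lia.
  by symmetry; apply: (item_frame hj2' hk hf2).
- move=> c hc; rewrite addn2 big_nat_recr /=; last by lia.
  rewrite -hsum // sumE {2}/upd eqxx addnC; congr (_ + _).
  by apply: eq_big_nat => j hj; rewrite /upd ifN //; lia.
Qed.

Lemma inv_frame d r sg sg' : 10 < d -> inv r sg ->
  frame d (reg sg 14 * S) sg sg' -> reg sg' 14 = reg sg 14 -> inv r sg'.
Proof.
move=> hd10 [h1 h2 h3 h4 h5 h6] hf e.
have hst v : status sg' v = status sg v by rewrite /status (frame_mem hf).
split; rewrite ?e //.
- exact: env_frame hd10 hf h1.
- by rewrite /arcs_todo (eq_bigr _ (fun a _ => congr1 (fun x => nat_of_bool (x == 0)) (hst _))).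
- by move=> v hv; rewrite hst h4.
- by move=> v c hv; rewrite hst; apply: h5.
- move=> v hv; rewrite hst => hlive; apply: (approx_frame _ hf) (h6 v hv hlive).
  exact: h4.
Qed.

Lemma arcs_todo_le sg : arcs_todo sg <= m.
Proof.
rewrite -[leqRHS]subn0 -[leqRHS]muln1 -sum_nat_const_nat; apply: leq_sum => a _.
exact: leq_b1.
Qed.

Lemma arcs_todo_upd sg sg' v z : (forall w, status sg' w = upd (status sg) v z w) ->
  0 < z -> status sg v = 0 -> arcs_todo sg' + deg v = arcs_todo sg.
Proof.
move=> h hz hv; rewrite /arcs_todo /deg /deg_upto -big_split; apply: eq_bigr => a _.
by rewrite h /upd; case: (eqVneq (tl a) v) => [->|_] /=;
  [rewrite hv -(prednK hz) | rewrite addn0].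
Qed.

Lemma inv_processed r rho v z sg sg2 :
  inv r sg -> v < n -> status sg v = 0 -> frame 14 (reg sg 14 * S) sg sg2 ->
  reg sg 14 <= reg sg2 14 <= reg sg 14 + deg v + deg v -> 0 < z < reg sg2 14 ->
  (z = 1 -> forall c, c <= C -> F v c = 0) ->
  (1 < z -> approx (item sg2 z) (F v) (r + rho)) ->
  inv (r + rho) (set_mem 6 v z sg2).
Proof.
move=> hinv hv hsv hf /andP[ht1 ht2] /andP[hz0 hz] hdead hlive.
have [h1 h2 h3 h4 h5 h6] := hinv.
set sg3 := set_mem 6 v z sg2.
have hst w : status sg3 w = upd (status sg) v z w.
  by rewrite /status /= {1}/upd /= (frame_mem hf).
have hit w k : item sg3 w k = item sg2 w k by [].
split.
- by case: (env_frame (isT : 10 < 14) hf h1).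
- exact: leq_trans ht1.
- by have := arcs_todo_upd hst hz0 hsv; rewrite /=; lia.
- move=> w hw; rewrite hst /upd; case: eqP => // _.
  by apply: leq_trans (h4 w hw) _.
- move=> w c hw; rewrite hst /upd; case: eqP => [->|_]; last exact: h5.
  by move=> e; apply: hdead.
- move=> w hw; rewrite hst /upd; case: eqP => [->|_] hlt; first exact: hlive.
  apply: approx_weaken (leq_addr rho r).
  by apply: (approx_frame (h4 w hw) hf) (h6 w hw hlt).
Qed.

Definition process_time (v : nat) (rdy : bool) :=
  check_time + (tsize (Eq (Reg 15) (Const 1)) * U
  + (if rdy then gather_time v + (tsize no_item * U
       + (combine_time (deg v) + csize (Put 6 (Reg 13) (Reg 17)) * U))
     else U)).

Lemma wp_process r sg v :
  inv r sg -> reg sg 13 = v -> v < n -> status sg v = 0 ->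
  let rdy := ready_upto sg v m in
  wp l L process sg (process_time v rdy) (fun sg' => 
    (forall x, x < 14 -> reg sg' x = reg sg x) /\
    if rdy then exists rho z,
      [/\ 0 < z, forall w, status sg' w = upd (status sg) v z w,
          2 ^ rho <= (deg v + deg v).+1 & inv (r + rho) sg']
    else (forall w, status sg' w = status sg w) /\ inv r sg').
Proof.
move=> hinv r13 hv hsv rdy.
apply: wp_seq; apply: wp_weaken (wp_check hinv) (leqnn _) _ => sg1 [hf1].
rewrite r13 => r15; have e14 : reg sg1 14 = reg sg 14 by rewrite (frame_reg hf1).
have hf1' : frame 14 (reg sg 14 * S) sg sg1 by apply: frame_weaken hf1.
have hinv1 := inv_frame (isT : 10 < 14) hinv hf1' e14.
have hst1 w : status sg1 w = status sg w by rewrite /status (frame_mem hf1).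
apply: (wp_if short_unit long_unit).
  by rewrite /=; safety.
rewrite /= r15 -/rdy; case hr: rdy => /=; last first.
  have U_gt0 : 0 < U by exact: leq_trans short_unit.
  exists 1, sg1; split=> //; first exact: exec_skip.
  by split=> // x hx; rewrite (frame_reg hf1') .
have s13 : reg sg1 13 = v by rewrite (frame_reg hf1).
have hsv1 : status sg1 v = 0 by rewrite hst1.
have hrdy a : a < m -> tl a = v -> status sg1 (hd a) != 0.
  move=> ha hta; move/allP: hr => /(_ a); rewrite mem_iota hta eqxx hst1 /=.
  by rewrite add0n; apply.
apply: wp_seq; apply: wp_weaken (wp_gather hinv1 s13 hv hsv1 hrdy) (leqnn _) _.
rewrite e14; set base := reg sg 14.
move=> sg2 [q [Phi [hf2 r17 [r14 hq] hPhi hsum]]].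
have hF c : c <= C -> \sum_(base <= j < base + q) Phi j c = F v c.
  by move=> hc; rewrite hsum // -F_rec.
have hf3 := frame_trans hf1' hf2.
have env2 : env sg2 by apply: env_frame hf3 (inv_env hinv).
have htop := inv_top hinv; have hdeg := deg_le_todo hsv; have hX := top_bound hinv.
have hgt1 := inv_gt1 hinv; have U_gt0 : 0 < U by exact: leq_trans short_unit.
have hX2 : (base + q + q) * S <= X.
  by apply: leq_trans X_items; rewrite leq_mul2r; apply/orP; right; lia.
have hX3 : base + q + q <= X by apply: leq_trans hX2; rewrite leq_pmulr; lia.
have t13 : reg sg2 13 = v by rewrite (frame_reg hf3).
apply: (wp_if short_unit long_unit).
  by rewrite /= r17 r14; safety.
rewrite /= r17 r14 -[X in X == _]addn0 eqn_add2l eq_sym; case: eqP => [q0|/eqP q0].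
  apply: wp_weaken (wp_straight short_unit long_unit (P := Put 6 (Reg 13) (Const 1)) _ _) _ _.
  - by rewrite /= t13; safety.
  - exact: erefl.
  - by rewrite (leq_trans _ (leq_addl _ _)) // leq_mul2r /= orbT.
  move=> _ <-; rewrite /= t13; split.
    by move=> x hx /=; rewrite (frame_reg hf3).
  exists 0, 1; split=> //.
    by move=> w; rewrite /status /= {1}/upd /= (frame_mem hf3).
  apply: inv_processed hf3 _ _ _ _ => //; rewrite ?r14; try lia.
  by move=> _ c hc; rewrite -hF // q0 addn0 big_geq.
apply: wp_seq; apply: wp_weaken (wp_combine env2 r17 r14 _ hX2 hPhi hF _) _ _.
- by rewrite lt0n.
- by move=> c hc; apply: F_bound.
- by rewrite leq_add2r leq_mul2r hq orbT.
move=> sg4 [rho [hf4 [s14 s17] hlt hrho hA]].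
have hf5 := frame_trans hf3 hf4.
apply: (wp_straight short_unit long_unit).
  by rewrite /= (frame_reg hf5) // r13; safety.
rewrite /= (frame_reg hf5) // r13; split.
  by move=> x hx /=; rewrite (frame_reg hf5).
exists rho, (reg sg4 17); split; first lia.
- by move=> w; rewrite /status /= {1}/upd /= (frame_mem hf5).
- by lia.
by apply: inv_processed hf5 _ _ _ _ => //; lia.
Qed.

Definition vertices_todo sg := \sum_(0 <= v < n) (status sg v == 0).

(** Paid at each of the at most n^2 visits, ready or not, whereas [big_time] is paid once for every
    arc, when its tail is processed. *)
Definition small_time :=
  check_time + tsize (Eq (Reg 15) (Const 1)) * U + csize gather_init * U
  + m * gather_arc_time + tsize arcs_left * U + tsize no_item * U
  + tsize two_queued * U + csize (Put 6 (Reg 13) (Reg 17)) * U + U.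

Definition big_time := copy_budget
  + (merge_time + csize combine_step * U + tsize two_queued * U).

Lemma process_time_le v rdy :
  process_time v rdy <= small_time + (if rdy then deg v * big_time else 0).
Proof.
rewrite /process_time /small_time /big_time /gather_time.
rewrite /combine_time -/(deg v) [deg v * (copy_budget + _)]mulnDr.
move: (deg v * copy_budget) (deg v * _) => y1 y2.
move: (check_time) (m * _) => y3 y4.
by case: rdy; lia.
Qed.

Lemma vertices_todo_upd sg sg' v z :
  (forall w, status sg' w = upd (status sg) v z w) ->
  0 < z -> status sg v = 0 -> v < n ->
  (vertices_todo sg').+1 = vertices_todo sg.
Proof.
move=> h hz hv hn; rewrite -addn1 -(sum_pred1 hn) /vertices_todo -big_split.
apply: eq_bigr => w _.
by rewrite h /upd; case: (eqVneq w v) => [->|_] /=;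
  [rewrite hv -(prednK hz) | rewrite addn0].
Qed.

(** * Reading off the answer *)

Definition output_time :=
  tsize has_list * U + (csize output_init * U
    + (K * (csize (incr 25) * U + tsize passed * U) + tsize passed * U
    + (3 * n + 13) * U)).

Lemma wp_output sg R s : inv R sg -> reg sg 2 = s -> s < n -> F s C <= 2 ^ n ->
  status sg s != 0 ->
  wp l L output sg output_time (fun sg' => reg sg' out_reg <= F s C /\
    F s C * M <= reg sg' out_reg * M + 2 * R * F s C).
Proof.
move=> hI r2 hs hF hst.
have env0 := inv_env hI; have htop := top_bound hI.
have hst2 := inv_status hI (ltnW hs).
have U_gt0 : 0 < U by exact: leq_trans short_unit.
apply: (wp_if short_unit long_unit).
  by rewrite /= r2; safety.
rewrite /= r2 -/(status sg s); case: ltnP => hlive; last first.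
  have e1 : status sg s = 1 by lia.
  have := inv_dead hI (ltnW hs) e1 (leqnn C) => hF0.
  apply: wp_weaken (wp_straight short_unit long_unit (P := Set_ out_reg (Const 0)) _ _) _ _.
  - by rewrite /=; safety.
  - exact: erefl.
  - by rewrite /=; lia.
  - by move=> _ <-; rewrite /= /upd /= hF0 !muln0.
have hA := inv_live hI (ltnW hs) hlive.
set z := status sg s in hst2 hlive hA *; pose T := item sg z.
have e2 := env_C env0; have e4 := env_b env0.
have hz : z * S + S <= X.
  apply: leq_trans X_items; rewrite addnC -mulSn leq_mul2r; apply/orP; right.
  by have := inv_top hI; lia.
have hz0 : z <= z * S by rewrite leq_pmulr; lia.
have T0 : T 0 = 0 := approx0 hA.
have TK : T K = C.+1 := approx_last hA.
have hT k : k <= K -> T k <= C.+1 by exact: (approx_le_last hA).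
apply: wp_seq; apply: (wp_straight short_unit long_unit).
  by rewrite /= /upd /= r2 -/(status sg s) -/z e4 S_def; safety.
pose I k sg' := [/\ k < K, reg sg' 25 = k, reg sg' 20 = z * S,
  frame 20 (reg sg 14 * S) sg sg' & T k <= C].
apply: wp_seq; apply: (@wp_while _ _ _ _ _ short_unit long_unit _ _ _ _ I); last first.
  split=> //; first by rewrite /= /upd /= r2 -/(status sg s) -/z e4 S_def.
    by do ![apply: frame_set => //].
  by rewrite T0.
move=> k sg' [hk r25 r20 hf hTk].
have hnext : mem sg' 5 (z * S + (k + 1)) = T k.+1.
  by rewrite addn1; apply: (item_frame hst2 hk hf).
have s4 : reg sg' 4 = C by rewrite (frame_reg hf).
have := hT _ hk => hT1.
rewrite /= r25 r20 hnext s4; split; first by safety.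
case: (leqP (T k.+1) C) => hTk1.
  split=> //; have hk1 : k.+1 < K.
    rewrite ltn_neqAle hk andbT; apply/eqP => e.
    by move: hTk1; rewrite e TK ltnn.
  apply: (wp_straight short_unit long_unit).
    by rewrite /= r25; safety.
  by split=> //; rewrite /= /upd /= ?r25 ?addn1 //; apply: frame_set.
split; first exact: ltnW.
have env1 := env_frame (isT : 10 < 20) hf env0.
have e8 := env_mant env1 (ltnW hk); have e9 := env_expo env1 (ltnW hk).
have hG : gval M k <= F s C by apply: (approx_sound hA) => //; exact: ltnW.
have he : expo M k <= n.+2 by apply: expo_le => //; rewrite -K_def ltnW.
have hk2 : k <= X by lia.
have c1 : words l (nbits k) <= U.
  apply: leq_trans short_unit; apply: leq_words.
  by rewrite (leq_trans (leq_nbits hk2)) ?leq_addr.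
(* Here a count is written out for the only time. It has at most n + 1 bits and need not respect the
   limits X and Y, so the O(n) cost of the shift is computed by hand. *)
eexists; eexists; split; first exact: exec_set.
  rewrite /decode /= r25 e8 e9 -/(gval M k).
  have := nbits_le_exp (leq_trans hG hF).
  have := leq_trans (nbits_le _) he => h1 h2.
  have := words_le L (nbits (gval M k)); have := words_le l (nbits (gval M k) + nbits (expo M k)).
  move=> h3 h4.
  have h5 : 3 * n + 9 <= (3 * n + 9) * U by rewrite leq_pmulr.
  have h6 : (3 * n + 13) * U = (3 * n + 9) * U + 4 * U by rewrite -mulnDl -addnA.
  lia.
rewrite /= /upd /= r25 e8 e9 -/(gval M k); split=> //.
have [k0 [hk0 hT0 hF0]] := approx_complete hA (leqnn C).
have hkk : k0 <= k.
  rewrite leqNgt; apply/negP => h.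
  have h2 : T k.+1 <= T k0 := approx_leq hA h hk0.
  by move: (leq_trans h2 hT0); rewrite leqNgt hTk1.
apply: (leq_trans hF0); rewrite leq_add2r leq_mul2r; apply/orP; right.
exact: leq_gval.
Qed.

(** * Rounds over all vertices: time and error *)

Variables (rk : nat -> nat) (Q : nat).
Hypothesis rk_arc : forall a, a < m -> hd a < n -> rk (hd a) < rk (tl a).
Hypothesis rk_lt : forall v, v < n -> rk v < n.
Hypothesis n_gt0 : 0 < n.
Hypothesis Q_m : m <= (n * 2 ^ Q).*2.

Definition vertex_time :=
  tsize rounds_left * U + tsize unprocessed * U + small_time
  + csize next_vertex * U.

Definition rounds_time :=
  csize rounds_init * U
  + (n * n * vertex_time + m * big_time + tsize rounds_left * U).

(** An unprocessed vertex of degree d may still add Q + 1 + d / 2 ^ Q to the error, by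
    [depth_bound]; everything is multiplied by 2 ^ Q to stay in the integers. *)
Definition depth_budget R sg :=
  R * 2 ^ Q + vertices_todo sg * (Q.+1 * 2 ^ Q) + arcs_todo sg
  <= n * (Q.+1 * 2 ^ Q) + m.

Lemma vertices_todo_le sg : vertices_todo sg <= n.
Proof.
rewrite -[leqRHS]subn0 -[leqRHS]muln1 -sum_nat_const_nat; apply: leq_sum => a _.
exact: leq_b1.
Qed.

Lemma wp_rounds sg : inv 0 sg -> status sg n != 0 ->
  wp l L rounds sg rounds_time (fun sg' => exists R,
    [/\ inv R sg', R <= n * (Q + 3), forall x, x < 12 -> reg sg' x = reg sg x &
        forall v, v <= n -> status sg' v != 0]).
Proof.
move=> hinv hn.
apply: wp_seq; apply: (wp_straight short_unit long_unit).
  by rewrite /=; safety.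
have U_gt0 : 0 < U by exact: leq_trans short_unit.
(* In round [r], at vertex [v]. A vertex of rank at most [r] becomes processed in round [r] at the
   latest: its heads of smaller rank were done in earlier rounds, and the additional vertex [n] is
   done from the start. *)
pose I i sg' := exists r v R,
  [/\ i + arcs_todo sg' * big_time <= (r * n + v) * vertex_time + m * big_time,
    r <= n /\ (if r < n then v < n else v == 0),
    [/\ reg sg' 12 = r, reg sg' 13 = v & forall x, x < 12 -> reg sg' x = reg sg x],
    [/\ inv R sg', depth_budget R sg' & status sg' n != 0] &
    (forall w, w < n -> rk w < r -> status sg' w != 0) /\
    (forall w, w < v -> rk w <= r -> status sg' w != 0)].
apply: (@wp_while_budget _ _ _ _ _ short_unit long_unit _ _ _
  I); last first.
  set sg0 := sexec _ _; have hA := arcs_todo_le sg0; have hV := vertices_todo_le sg0.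
  have hf0 : frame 12 (reg sg 14 * S) sg sg0 by do ![apply: frame_set => //].
  exists 0, 0, 0; split=> //.
  - by rewrite add0n mul0n add0n leq_mul2r hA orbT.
  - by rewrite n_gt0.
  - by split=> //; exact: frame_reg hf0.
  - split=> //; last first.
      by rewrite /depth_budget mul0n add0n leq_add // leq_mul2r hV orbT.
    exact: (inv_frame (isT : 10 < 12) hinv hf0).
move=> i sg' [r [v [R [hi [hr hv] [r12 r13 hreg] [hI hD hn'] [hd1 hd2]]]]].
have env1 := inv_env hI; have [e0 e1 e2 e3 e4 e5 e6 e7 _ _] := env1.
rewrite /= r12 e0 addn1; split; first by safety.
  have : r * n + v <= n * n.
    case: ltnP hv => [h1 h2|h1 /eqP->].
      apply: (@leq_trans (r.+1 * n)); first by rewrite mulSn; lia.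
      by rewrite leq_mul2r h1 orbT.
    by rewrite addn0 leq_mul2r hr orbT.
  move=> h; rewrite leq_add2r; apply: leq_trans (leq_addr _ _) (leq_trans hi _).
  by rewrite leq_add2r leq_mul2r h orbT.
case: (ltnP r n) hv => [hrn hv|hrn /eqP hv]; last first.
  have ern : r = n by lia.
  exists R; split=> //.
    (* The budget now says R <= n (Q + 1) + m / 2 ^ Q, and the last term is at most 2 n by the
       choice of Q. *)
    have h : R * 2 ^ Q <= n * (Q.+1 * 2 ^ Q) + m.
      by apply: leq_trans hD; rewrite -addnA leq_addr.
    have : R * 2 ^ Q <= n * (Q + 3) * 2 ^ Q.
      apply: (leq_trans h); move: Q_m; rewrite !addnS addn0 -muln2 => Q_m'.
      by rewrite -mulnA !mulSn; lia.
    by rewrite leq_mul2r expn_eq0.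
  move=> w; rewrite leq_eqVlt => /orP[/eqP->//|hw].
  by apply: hd1 => //; rewrite ern rk_lt.
set rdy := ready_upto sg' v m.
pose extra := if (status sg' v == 0) && rdy then deg v * big_time else 0.
exists (tsize unprocessed * U + (small_time + extra) + csize next_vertex * U).
suff Hif : wp l L (If unprocessed process Skip) sg'
    (tsize unprocessed * U + (small_time + extra)) (fun sg2 => exists R2,
    [/\ arcs_todo sg2 * big_time + extra = arcs_todo sg' * big_time,
        inv R2 sg2, depth_budget R2 sg2,
        forall x, x < 14 -> reg sg2 x = reg sg' x &
        (forall w, status sg' w != 0 -> status sg2 w != 0) /\
        (rk v <= r -> status sg2 v != 0)]).
  apply: wp_seq; apply: wp_weaken Hif (leqnn _) _.
  move=> sg2 [R2 [hA2 hI2 hD2 hreg2 [hs1 hs2]]].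
  have t12 : reg sg2 12 = r by rewrite hreg2.
  have t13 : reg sg2 13 = v by rewrite hreg2.
  have t0 : reg sg2 0 = n by rewrite hreg2.
  apply: (wp_straight short_unit long_unit).
    rewrite /= /upd /= t13 t0 addn1; split; first by safety.
    by split; [safety | case: ifP => _ //; rewrite /= /upd /= t12; safety].
  set sg3 := sexec _ _.
  have hst3 w : status sg3 w = status sg2 w.
    by rewrite /sg3 /= /upd /= t13 t0; case: ifP.
  have hA3 : arcs_todo sg3 = arcs_todo sg2.
    by apply: eq_bigr => a _; rewrite hst3.
  have hV3 : vertices_todo sg3 = vertices_todo sg2.
    by apply: eq_bigr => a _; rewrite hst3.
  have hf3 : frame 12 (reg sg2 14 * S) sg2 sg3.
    by rewrite /sg3 /=; case: ifP => _; do ![apply: frame_set => //].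
  have hI3 : inv R2 sg3.
    apply: (inv_frame (isT : 10 < 12) hI2 hf3).
    by rewrite /sg3 /=; case: ifP.
  have hreg3 x : x < 12 -> reg sg3 x = reg sg x.
    by move=> hx; rewrite (frame_reg hf3) // hreg2 ?hreg // (ltn_trans hx).
  have hdone w : status sg' w != 0 -> status sg3 w != 0 by rewrite hst3; exact: hs1.
  have hcost r' v' : r' * n + v' = (r * n + v).+1 ->
      i + tsize rounds_left * U
      + (tsize unprocessed * U + (small_time + extra) + csize next_vertex * U)
      + arcs_todo sg3 * big_time <= (r' * n + v') * vertex_time + m * big_time.
    move=> ->; have : vertex_time = tsize rounds_left * U + tsize unprocessed * U
      + small_time + csize next_vertex * U by [].
    move: hi hA2; rewrite hA3 mulSn; move: (_ * vertex_time) => y; move: vertex_time => x.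
    by lia.
  eexists; first exact: leqnn.
  case: (eqVneq v.+1 n) => hvn.
    exists r.+1, 0, R2; split=> //.
    - by apply: hcost; rewrite mulSn; lia.
    - by rewrite n_gt0 if_same.
    - split; last exact: hreg3;
        by rewrite /sg3 /= /upd /= t13 t0 addn1 hvn eqxx /= /upd /= ?t12 ?addn1.
    - by split=> //; [rewrite /depth_budget hA3 hV3; exact: hD2 | exact: hdone].
    - split=> // w hw; rewrite ltnS => hrw.
      case: (eqVneq w v) hrw => [->|hwv] hrw; first by rewrite hst3; exact: hs2.
      by apply: hdone; apply: hd2 => //; lia.
  exists r, v.+1, R2; split=> //.
  - by apply: hcost; rewrite addnS.
  - by split=> //; rewrite hrn; lia.
  - split; last exact: hreg3;
      by rewrite /sg3 /= /upd /= t13 t0 addn1 (negbTE hvn) /= /upd /= ?t12 ?t13 ?addn1.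
  - by split=> //; [rewrite /depth_budget hA3 hV3; exact: hD2 | exact: hdone].
  - split=> w; first by move=> hw hrw; apply: hdone; exact: hd1.
    rewrite ltnS leq_eqVlt => /orP[/eqP->|hwv] hrw; last by apply: hdone; exact: hd2.
    by rewrite hst3; exact: hs2.
have htop := top_bound hI; have hst := inv_status hI (ltnW hv).
have s13 : reg sg' 13 = v := r13.
apply: (wp_if short_unit long_unit).
  by rewrite /= r13; safety.
rewrite /= r13 -/(status sg' v) /extra; case: (eqVneq (status sg' v) 0) => hsv /=; last first.
  exists 1, sg'; split=> //; first exact: exec_skip.
    by rewrite /small_time; lia.
  by exists R; rewrite addn0; split.
apply: wp_weaken (wp_process hI r13 hv hsv) _ _.
  exact: process_time_le.
move=> sg2 [hreg2]; rewrite -/rdy; case: ifP => hrdy; last first.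
  move=> [hst2 hI2].
  exists R; split=> //.
  - rewrite addn0; congr (_ * _).
    by apply: eq_bigr => a _; rewrite hst2.
  - rewrite /depth_budget (_ : arcs_todo sg2 = arcs_todo sg'); last first.
      by apply: eq_bigr => a _; rewrite hst2.
    rewrite (_ : vertices_todo sg2 = vertices_todo sg') //.
    by apply: eq_bigr => a _; rewrite hst2.
  - split=> [w|hrk]; first by rewrite hst2.
    move: hrdy; rewrite /rdy => /negP[]; apply/allP => a; rewrite mem_iota add0n => /andP[_ ha].
    apply/implyP => /eqP hta; case: (eqVneq (hd a) n) => [->//|hne].
    have hdn : hd a < n by rewrite ltn_neqAle hne hd_le.
    by apply: hd1 => //; apply: leq_trans (rk_arc ha hdn) _; rewrite hta.
move=> [rho [z [hz hst2 hrho hI2]]].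
have hA := arcs_todo_upd hst2 hz hsv; rewrite -/arcs_todo -/(deg v) in hA.
have hV := vertices_todo_upd hst2 hz hsv hv.
exists (R + rho); split=> //.
- by rewrite -mulnDl hA.
- have := depth_bound Q hrho; rewrite -/(deg v); move: hD; rewrite /depth_budget -hA -hV.
  by rewrite mulSn (mulnDl R); lia.
- split=> [w hw|_]; rewrite hst2 /upd ?eqxx; last by rewrite -lt0n.
  by case: (w == v); rewrite ?hw -?lt0n.
Qed.

End Run.

(** * Initialization *)

Definition keeps (xs : seq nat) (sg sg' : state) :=
  (forall x, x \notin xs -> reg sg' x = reg sg x) /\ mem sg' = mem sg.

Lemma keeps_set xs x v sg sg' :
  x \in xs -> keeps xs sg sg' -> keeps xs sg (set_reg x v sg').
Proof.
move=> hx [h1 h2]; split=> //= y hy; rewrite /upd ifN ?h1 //.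
by apply: contra hy => /eqP->.
Qed.

Section Loops.

Variables X Y l L U : nat.
Hypothesis short_unit : words l (nbits X + nbits X) <= U.
Hypothesis long_unit : words L (nbits Y + nbits Y) <= U.
Hypothesis X_lt_Y : X < Y.

Definition multiply_time y bound step n :=
  csize (multiply_init y) * U
  + (n * (csize (multiply_body y step) * U + tsize (below 12 bound) * U)
     + tsize (below 12 bound) * U).

Lemma wp_multiply sg y bound step n d : y != 12 ->
  (forall sg', keeps [:: 12; y] sg sg' ->
    [/\ eval sg' bound = n, eval sg' step = d, esafe X Y sg' bound
      & esafe X Y sg' step]) ->
  n <= X -> d <= X -> n * d <= X ->
  wp l L (multiply y bound step) sg (multiply_time y bound step n)
    (fun sg' => keeps [:: 12; y] sg sg' /\ reg sg' y = n * d).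
Proof.
move=> hy he hn hd hX.
have y12 : (y == 12) = false by apply: negbTE.
have y12' : (12 == y) = false by rewrite eq_sym.
apply: wp_seq; apply: (wp_straight short_unit long_unit).
  by rewrite /=; safety.
pose I i sg' := [/\ i <= n, reg sg' 12 = i, reg sg' y = i * d
  & keeps [:: 12; y] sg sg'].
apply: (@wp_while _ _ _ _ _ short_unit long_unit _ _ _ _ I); last first.
  split=> //; first by rewrite /= /upd y12 eqxx.
  by do ![apply: keeps_set; first by rewrite !inE eqxx ?orbT].
move=> i sg' [hi r12 ry hk]; have [e1 e2 s1 s2] := he sg' hk.
rewrite /= r12 e1 addn1; split; first by safety.
case: (ltnP i n) => hin; last first.
  by split=> //; split=> //; rewrite ry; congr (_ * _); lia.
split=> //.
have h1 : i.+1 * d <= X by apply: leq_trans hX; rewrite leq_mul2r hin orbT.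
rewrite mulSn in h1.
apply: (wp_straight short_unit long_unit).
  by rewrite /= /upd y12' r12 ry e2; safety.
split=> //=; rewrite /upd ?eqxx ?y12 ?y12' ?r12 ?ry ?e2 ?addn1 //.
  by rewrite mulSn addnC.
by do ![apply: keeps_set; first by rewrite !inE eqxx ?orbT].
Qed.

Definition double_time y start k bound q :=
  csize (double_init y start k) * U
  + (q * (csize (double_body y) * U + tsize (below 11 bound) * U)
     + tsize (below 11 bound) * U).

Lemma wp_double sg y start k bound a n q : y != 11 ->
  (forall sg', keeps [:: 11; y] sg sg' ->
    eval sg' bound = n /\ esafe X Y sg' bound) ->
  eval sg start = a -> esafe X Y sg start ->
  n <= a * 2 ^ q -> (forall j, j < q -> a * 2 ^ j < n) ->
  a <= X -> n + n <= X -> k + q <= X ->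
  wp l L (double y start k bound) sg (double_time y start k bound q)
    (fun sg' => [/\ keeps [:: 11; y] sg sg', reg sg' 11 = a * 2 ^ q
      & reg sg' y = k + q]).
Proof.
move=> hy he ea hs hq hj haX hnX hkX.
have y11 : (y == 11) = false by apply: negbTE.
have y11' : (11 == y) = false by rewrite eq_sym.
have hXi i : i <= q -> a * 2 ^ i <= X.
  case: i => [|i] hi; first by rewrite muln1.
  by have := hj i hi; rewrite expnS mulnCA mul2n -addnn; lia.
apply: wp_seq; apply: (wp_straight short_unit long_unit).
  by rewrite /= ea; safety.
pose I i sg' := [/\ i <= q, reg sg' 11 = a * 2 ^ i, reg sg' y = k + i
  & keeps [:: 11; y] sg sg'].
apply: (@wp_while _ _ _ _ _ short_unit long_unit _ _ _ _ I); last first.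
  split=> //; rewrite /= /upd ?eqxx ?y11' ?ea ?muln1 ?addn0 //.
  by do ![apply: keeps_set; first by rewrite !inE eqxx ?orbT].
move=> i sg' [hi r11 ry hk]; have [e1 s1] := he sg' hk.
rewrite /= r11 e1 addn1.
have hX := hXi i hi.
split; first by safety.
case: (ltnP (a * 2 ^ i) n) => hin; last first.
  have eiq : i = q.
    by apply/eqP; rewrite eqn_leq hi leqNgt; apply/negP => /hj; rewrite ltnNge hin.
  by split=> //; rewrite -eiq.
have hiq : i < q.
  rewrite ltnNge; apply/negP => h; have e : i = q by lia.
  by move: hin; rewrite e ltnNge hq.
split=> //.
apply: (wp_straight short_unit long_unit).
  by rewrite /= /upd y11 r11 ry; safety.
split=> //=; rewrite /upd ?eqxx ?y11 ?y11' ?r11 ?ry ?addn1 ?addnS //.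
  by rewrite expnS mulnCA mul2n -addnn.
by do ![apply: keeps_set; first by rewrite !inE eqxx ?orbT].
Qed.

End Loops.

(** * Parameters, grid and the first list *)

Section Setup.

Variables (n m C M K b S X Y l L U Q E : nat) (tl hd wt : nat -> nat).
Hypothesis M_def : M = n * (3 + Q) * (E + E).
Hypothesis K_def : K = n.+2 * M.
Hypothesis S_def : 2 ^ b = S.
Hypothesis X_def : X = (m + m + 4) * S + n + 3.
Hypothesis Y_def : Y = X + C.+1 + C.+1.
Hypothesis n_gt0 : 0 < n.
Hypothesis m_gt0 : 0 < m.
Hypothesis E_gt0 : 0 < E.
Hypothesis Q_ge : m <= n * 2 ^ Q.
Hypothesis Q_min : forall j, j < Q -> n * 2 ^ j < m.
Hypothesis b_ge : K < S.
Hypothesis b_min : forall j, j < b -> 2 ^ j <= K.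
Hypothesis short_unit : words l (nbits X + nbits X) <= U.
Hypothesis long_unit : words L (nbits Y + nbits Y) <= U.

Let Q_M : n + 2 + Q <= n * (3 + Q).
Proof. by case: n n_gt0 => // p _; have := leq_pmulr p (ltn0Sn Q.+2); rewrite mulSn; lia. Qed.

Let x_M : n * (3 + Q) + n * (3 + Q) <= M.
Proof. by rewrite M_def addnn -muln2 leq_mul2l; apply/orP; right; lia. Qed.

Let E_M : E + E <= M.
Proof. by rewrite M_def leq_pmull // muln_gt0 n_gt0. Qed.

Let K_ge : M + M + M <= K.
Proof. by rewrite K_def; case: n n_gt0 => // p _; rewrite !mulSn; lia. Qed.

Let S_X : S + S + S + S + S + S + n + 3 <= X.
Proof.
have : 6 * S <= (m + m + 4) * S by rewrite leq_mul2r; apply/orP; right; lia.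
by rewrite X_def !mulSn; lia.
Qed.

Let m_X : m + m + 4 + n + 3 <= X.
Proof.
have S_gt0 : 0 < S by exact: leq_ltn_trans b_ge.
by have := leq_pmulr (m + m + 4) S_gt0; lia.
Qed.

Let b_S : b < S.
Proof. by rewrite -S_def ltn_expl. Qed.

Lemma setup_sizes : sizes n m C M K b S X Y l L U.
Proof.
by split=> //; lia.
Qed.

Let X_lt_Y : X < Y.
Proof. by lia. Qed.

Definition parameters_time :=
  double_time U 6 (Reg 0) 3 (Reg 1) Q
  + (multiply_time U 7 (Reg 0) (Reg 6) n
  + (multiply_time U 8 (Reg 7) (Add (Reg 5) (Reg 5)) (n * (3 + Q))
  + (multiply_time U 9 (Add (Reg 0) (Const 2)) (Reg 8) n.+2
  + double_time U 10 (Const 1) 0 (Add (Reg 9) (Const 1)) b))).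

Lemma wp_parameters sg : reg sg 0 = n -> reg sg 1 = m -> reg sg 5 = E ->
  wp l L parameters sg parameters_time (fun sg' =>
    [/\ forall x, x < 6 -> reg sg' x = reg sg x, mem sg' = mem sg
      & [/\ reg sg' 8 = M, reg sg' 9 = K & reg sg' 10 = b]]).
Proof.
move=> r0 r1 r5.
apply: wp_seq; apply: wp_weaken (leqnn _) _.
  apply: (wp_double short_unit long_unit X_lt_Y (a := n) (n := m) (q := Q)) => //.
  - by move=> sg' [h _] /=; rewrite h // r1.
  - by lia.
  - by lia.
  - by lia.
move=> sg1 [[h1 hm1] _ s6].
apply: wp_seq; apply: wp_weaken (leqnn _) _.
  apply: (wp_multiply short_unit long_unit X_lt_Y (n := n) (d := 3 + Q)) => //.
  - by move=> sg' [h _] /=; rewrite !h // s6 h1.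
  - by lia.
  - by lia.
  - by lia.
move=> sg2 [[h2 hm2] s7].
apply: wp_seq; apply: wp_weaken (leqnn _) _.
  apply: (wp_multiply short_unit long_unit X_lt_Y (n := n * (3 + Q)) (d := E + E)) => //.
  - by move=> sg' [h _] /=; rewrite !h // s7 h2 // h1 // r5; split=> //; split=> //; lia.
  - by lia.
  - by lia.
  - by rewrite -M_def; lia.
rewrite -M_def => sg3 [[h3 hm3] s8].
apply: wp_seq; apply: wp_weaken (leqnn _) _.
  apply: (wp_multiply short_unit long_unit X_lt_Y (n := n.+2) (d := M)) => //.
  - move=> sg' [h _] /=; rewrite !h // s8 h3 // h2 // h1 // r0 addn2.
    by split=> //; split=> //; lia.
  - by lia.
  - by lia.
  - by rewrite -K_def; lia.
rewrite -K_def => sg4 [[h4 hm4] s9].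
apply: wp_weaken (leqnn _) _.
  apply: (wp_double short_unit long_unit X_lt_Y (a := 1) (n := K.+1) (q := b)) => //.
  - by move=> sg' [h _] /=; rewrite h // s9 addn1; split=> //; split=> //; lia.
  - by rewrite mul1n S_def.
  - by move=> j hj; rewrite mul1n ltnS b_min.
  - by lia.
  - by lia.
  - by lia.
move=> sg5 [[h5 hm5] _ s10]; split; last by rewrite s10 h5 // h4 // s8 h5 // s9.
  move=> x hx; have hn y : 5 < y -> (x == y) = false by move=> hy; apply/eqP; lia.
  by rewrite h5 ?h4 ?h3 ?h2 ?h1 // !inE !hn.
by rewrite hm5 hm4 hm3 hm2.
Qed.

Definition setup_time :=
  csize add_arc * U + (parameters_time + (csize grid_init * U
  + ((K.+1 * (csize grid_body * U + tsize all_entries * U)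
      + tsize all_entries * U) + csize last_list * U))).

Variable F : nat -> nat -> nat.
Hypothesis F_last : forall c, F n c = 1.

(** Here [m] includes the additional arc, so register 1 starts at m - 1. The weight of that arc is 0
    and need not be written, as cells past the input hold 0. *)
Lemma wp_setup sg t :
  [/\ reg sg 0 = n, reg sg 1 = m.-1, reg sg 3 = t, reg sg 4 = C & reg sg 5 = E] ->
  (forall a, a < m.-1 -> mem sg 0 a = tl a /\ mem sg 1 a = hd a) ->
  (forall a, a < m -> mem sg 2 a = wt a) ->
  tl m.-1 = t -> hd m.-1 = n -> t < n -> (forall v, v <= n -> mem sg 6 v = 0) ->
  wp l L setup sg setup_time (fun sg' =>
    [/\ inv n m C M K b S tl hd wt F 0 sg', status sg' n != 0
      & reg sg' 2 = reg sg 2]).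
Proof.
move=> [r0 r1 r3 r4 r5] harc hwt htl hhd ht h6.
have hsz := setup_sizes; have [_ _ M_gt1 _ _ _ _ _ _ _ _ _ _ _] := hsz.
apply: wp_seq; apply: (wp_straight short_unit long_unit).
  by rewrite /= /upd /= r0 r1 r3; safety.
set sg1 := sexec _ _.
have hm1 : m.-1.+1 = m by rewrite prednK.
have s1 : reg sg1 1 = m by rewrite /= /upd /= r1 addn1.
have arc1 a : a < m -> [/\ mem sg1 0 a = tl a, mem sg1 1 a = hd a & mem sg1 2 a = wt a].
  move=> ha; rewrite /= /upd /= r0 r1 r3; case: (eqVneq a m.-1) => [->|hne].
    by rewrite htl hhd hwt //; lia.
  have ha' : a < m.-1 by lia.
  by have [-> ->] := harc a ha'; rewrite hwt.
have st1 v : v <= n -> mem sg1 6 v = 0 by move=> hv; rewrite /= /upd /= h6.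
have s0 : reg sg1 0 = n by [].
have s5 : reg sg1 5 = E by [].
have s4 : reg sg1 4 = C by [].
have s2 : reg sg1 2 = reg sg 2 by [].
move: sg1 s0 s1 s2 s4 s5 arc1 st1 => sg1 s0 s1 s2 s4 s5 arc1 st1.
apply: wp_seq; apply: wp_weaken (wp_parameters s0 s1 s5) (leqnn _) _.
move=> sg2 [hr hm [t8 t9 t10]].
apply: wp_seq; apply: (wp_straight short_unit long_unit).
  by rewrite /= /upd /= t10 S_def; safety.
set sg3 := sexec _ _.
have u20 : reg sg3 20 = 2 * S by rewrite /= /upd /= t10 S_def.
have ur x : x < 20 -> reg sg3 x = reg sg2 x.
  by move=> hx; rewrite /= /upd !ifN // neq_ltn (leq_trans hx).
have um : mem sg3 = mem sg1 by rewrite /= hm.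
have u25 : reg sg3 25 = 0 by [].
have u26 : reg sg3 26 = 0 by [].
have u27 : reg sg3 27 = 0 by [].
move: sg3 u20 ur um u25 u26 u27 => sg3 u20 ur um u25 u26 u27.
pose I k sg' := [/\ k <= K.+1,
  [/\ reg sg' 25 = k, reg sg' 26 = mant M k, reg sg' 27 = expo M k & reg sg' 20 = 2 * S],
  forall x, x < 20 -> reg sg' x = reg sg2 x,
  forall a, a != 3 -> a != 4 -> a != 5 -> mem sg' a = mem sg1 a &
  forall k', k' < k -> [/\ mem sg' 3 k' = mant M k', mem sg' 4 k' = expo M k' &
    mem sg' 5 (2 * S + k') = C.+1]].
apply: wp_seq; apply: (@wp_while _ _ _ _ _ short_unit long_unit _ _ _ _ I); last first.
  by split=> // a _ _ _; rewrite um.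
move=> k sg' [hk [r25 r26 r27 r20] hrr hmm hkk].
have q9 : reg sg' 9 = K by rewrite hrr.
have q8 : reg sg' 8 = M by rewrite hrr.
have q4 : reg sg' 4 = C by rewrite hrr // hr.
rewrite /= r25 q9; split; first by safety.
case: (leqP k K) => hkK; last first.
  split=> //; apply: (wp_straight short_unit long_unit).
    by rewrite /= /upd /= r20 !hrr // !hr // s0; safety.
  set sg4 := sexec _ _.
  have w0 : reg sg' 0 = n by rewrite hrr // hr.
  have st4 v : v <= n -> status sg4 v = if v == n then 2 else 0.
    by move=> hv; rewrite /status /= /upd /= w0 hmm // st1.
  have items k' : mem sg4 5 (2 * S + k') =
      if k' < 2 then 0 else mem sg' 5 (2 * S + k').
    have e : (2 * S + k' == 2 * S) = (k' == 0).
      by rewrite -[X in _ == X]addn0 eqn_add2l.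
    by rewrite /= /upd /= r20 e eqn_add2l; case: k' {e} => [|[|k']].
  split; last by rewrite /= /upd /= hrr // hr.
    split.
    - split; rewrite /= /upd /= ?hrr ?t9 ?t10 ?hr //.
      + by move=> a ha; rewrite hmm //; case: (arc1 a ha).
      + by move=> a ha; rewrite hmm //; case: (arc1 a ha).
      + by move=> a ha; rewrite hmm //; case: (arc1 a ha).
      + by move=> k' hk'; case: (hkk k'); rewrite // (leq_ltn_trans hk').
      + by move=> k' hk'; case: (hkk k'); rewrite // (leq_ltn_trans hk').
    - by rewrite /= /upd.
    - have := arcs_todo_le m tl sg4; have -> : reg sg4 14 = 3 by [].
      by lia.
    - by move=> v hv; rewrite st4 //; case: eqP.
    - by move=> v c hv; rewrite st4 //; case: eqP.
    - move=> v hv; rewrite st4 //; case: eqP => // -> _.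
      have [K_gt0 K_gt1] : 0 < K /\ 1 < K by lia.
      apply: approx_eq (approx_unit M_gt1 K_gt0 (T := item S sg4 2) _ _ _ K_gt1) => //.
      + by rewrite /item items.
      + by rewrite /item items.
      + move=> k' h1 h2; rewrite /item items ltnNge h1 /=.
        by case: (hkk k') => //; lia.
  by rewrite st4 // eqxx.
split=> //.
have [b1 b2] := grid_bounds hsz hkK.
have gS : grid M k.+1 = if (mant M k).+1 == M + M then (M, (expo M k).+1)
    else ((mant M k).+1, expo M k).
  by rewrite /mant /expo /=; case: (grid M k).
apply: (wp_straight short_unit long_unit).
  rewrite /= /upd /= r20 r25 r26 r27 q4 q8 addn1.
  split; first by safety.
  split; first by safety.
  split; first by safety.
  split; first by safety.
  split.
    by split; [safety | case: ifP => _ //=; rewrite /upd /= ?r27 ?q8; safety].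
  by case: ifP => _ /=; rewrite /upd /= ?r25; safety.
have hpast k' : k' < k -> (k' == k) = false /\ (2 * S + k' == 2 * S + k) = false.
  by move=> h; rewrite eqn_add2l ltn_eqF.
rewrite /= /upd /= r20 r25 r26 r27 q4 q8 !addn1.
have fin sg5 : reg sg5 25 = k.+1 ->
    reg sg5 26 = mant M k.+1 -> reg sg5 27 = expo M k.+1 ->
    (forall x, x < 25 -> reg sg5 x = reg sg' x) ->
    mem sg5 = mem (set_mem 5 (2 * S + k) C.+1
      (set_mem 4 k (expo M k) (set_mem 3 k (mant M k) sg'))) -> I k.+1 sg5.
  move=> v25 v26 v27 vr vm; split=> //.
  - by split=> //; rewrite vr.
  - by move=> x hx; rewrite vr ?hrr // (leq_trans hx).
  - by move=> a h3 h4 h5; rewrite vm /= /upd (negbTE h5) (negbTE h4) (negbTE h3) hmm.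
  - move=> k'; rewrite ltnS leq_eqVlt vm /= /upd /= => /orP[/eqP->|hlt].
      by rewrite !eqxx.
    by have [-> ->] := hpast k' hlt; exact: hkk.
case: ifP gS => hM gS; apply: fin; rewrite /= /upd /= ?/mant ?/expo ?gS /= ?r25 ?addn1 ?q8 //.
- by move=> x hx; rewrite !ifN //; apply/eqP; lia.
- by move=> x hx; rewrite !ifN //; apply/eqP; lia.
Qed.

End Setup.

(** * Paths *)

Section Paths.

Variables (V : finType) (arc : rel V) (wt : V -> V -> nat) (t : V).
Hypothesis arc_acyclic : acyclic arc.

(** A rank below the number of vertices that drops along every arc. The length of a longest path
    would serve as well, but counting reachable vertices takes no recursion. *)
Definition height (v : V) := #|[set u | connect arc v u]|.-1.

Lemma height_lt v : height v < #|V|.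
Proof.
have h : #|[set u | connect arc v u]| <= #|V| := max_card _.
by rewrite /height (leq_trans _ h) // prednK //; apply/card_gt0P; exists v; rewrite inE connect0.
Qed.

Lemma height_arc v x : arc v x -> height x < height v.
Proof.
move=> hvx; have pos u : 0 < #|[set u' | connect arc u u']|.
  by apply/card_gt0P; exists u; rewrite inE connect0.
rewrite /height -ltnS !prednK //.
apply: proper_card; apply/properP; split.
  apply/subsetP => u; rewrite !inE; apply: connect_trans; exact: connect1.
exists v; rewrite inE ?connect0 //; apply/negP => /connectP [p hp hl].
have : cycle arc (x :: p) by rewrite /= rcons_path hp -hl.
by move/arc_acyclic.
Qed.

Lemma path_uniq v p : path arc v p -> uniq (v :: p).
Proof.
move=> hp; apply: (@sorted_uniq _ (fun a b => height b < height a)).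
- by move=> a b c h1 h2; apply: ltn_trans h2 h1.
- by move=> a; rewrite ltnn.
- by rewrite /=; apply: sub_path hp; exact: height_arc.
Qed.

Lemma path_size v p : path arc v p -> size p < #|V|.
Proof. by move/path_uniq/card_uniqP => /= <-; exact: max_card. Qed.

(** An explicit enumeration, so that the recursion for the number of paths is read off the size of a
    concatenation. Acyclicity makes all walks simple, and the fuel [k] loses none once k + 1 is at
    least the number of vertices. *)
Fixpoint walks (k : nat) (v : V) (c : nat) : seq (seq V) :=
  (if v == t then [:: [::]] else [::]) ++
  if k is k'.+1 then
    flatten [seq [seq x :: p | p <- walks k' x (c - wt v x)] |
             x <- enum V & arc v x && (wt v x <= c)]
  else [::].

Lemma mem_walks k v c p : (p \in walks k v c) =
  [&& path arc v p, last v p == t, path_weight wt v p <= c & size p <= k].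
Proof.
elim: k v c p => [|k IH] v c p; rewrite /= mem_cat.
  rewrite in_nil orbF; case: p => [|x p] /=; last first.
    by rewrite ltn0 !andbF; case: ifP.
  by rewrite andbT; case: eqP.
have -> : (p \in if v == t then [:: [::]] else [::]) = (p == [::]) && (v == t).
  by case: eqP; rewrite ?inE ?andbT ?andbF.
case: p => [|x p] /=.
  rewrite leq0n andbT; case: eqP => //= _; apply/flatten_mapP => [[x _ /mapP[]]] //.
rewrite /path_weight /= -/(path_weight wt x p).
apply/flatten_mapP/idP => [[y]|].
  rewrite mem_filter => /andP[/andP[h1 h2] _] /mapP [q]; rewrite IH.
  case/and4P => h3 h4 h5 h6 [-> ->].
  by rewrite h1 h3 h4 ltnS h6 andbT /=; lia.
case/and4P => /andP[h1 h2] h3 h4 h5; exists x.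
  by rewrite mem_filter h1 mem_enum andbT /=; lia.
apply: map_f; rewrite IH h2 h3 (h5 : size p <= k) andbT /=; lia.
Qed.

Lemma uniq_walks k v c : uniq (walks k v c).
Proof.
elim: k v c => [|k IH] v c /=; first by case: ifP.
rewrite cat_uniq; apply/and3P; split; first by case: ifP.
  apply/hasPn => p /flatten_mapP [x _ /mapP[q _ ->]].
  by case: ifP.
elim: (enum V) (enum_uniq V) => //= x e IHe /andP[hx he].
case: ifP => _ /=; last exact: IHe.
rewrite cat_uniq (IHe he) andbT map_inj_uniq ?IH; last by move=> ? ? [].
apply/hasPn => p /flatten_mapP [y]; rewrite mem_filter => /andP[_ hy] /mapP[q _ ->].
by apply/mapP => [[q' _ [e' _]]]; move: hx; rewrite -e' hy.
Qed.

Lemma num_paths_walks k v c : #|V| <= k.+1 ->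
  num_paths arc wt v t c = size (walks k v c).
Proof.
move=> hk; rewrite /num_paths; set A := [set p | _].
rewrite cardE -(size_map val); apply: perm_size; apply: uniq_perm.
- by rewrite map_inj_uniq ?enum_uniq //; exact: val_inj.
- exact: uniq_walks.
move=> p; rewrite mem_walks; apply/mapP/idP => [[q]|].
  rewrite mem_enum inE /is_path => /andP[/and3P[h1 h2 h3] h4] ->.
  by rewrite h1 h2 h4 /= -ltnS (leq_trans (path_size h1)).
case/and4P => h1 h2 h3 h4.
have hs : size p <= #|V| by rewrite ltnW ?(path_size h1).
exists (Bseq hs) => //.
by rewrite mem_enum inE /is_path h1 h2 h3 (path_uniq h1).
Qed.

Lemma num_paths_rec v c : num_paths arc wt v t c =
  (v == t) + \sum_(x | arc v x && (wt v x <= c)) num_paths arc wt x t (c - wt v x).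
Proof.
have [k hk] : exists k, #|V| <= k by exists #|V|.
rewrite (@num_paths_walks k.+1); last by rewrite (leq_trans hk) ?leqW.
rewrite /= size_cat; congr (_ + _); first by case: eqP.
rewrite size_flatten /shape -map_comp sumnE big_map big_filter big_enum_cond /=.
by apply: eq_bigr => x _; rewrite size_map -num_paths_walks // leqW.
Qed.

Lemma num_paths_mono v c1 c2 : c1 <= c2 ->
  num_paths arc wt v t c1 <= num_paths arc wt v t c2.
Proof.
move=> h; apply: subset_leq_card; apply/subsetP => p; rewrite !inE.
by case/andP => -> h'; rewrite (leq_trans h').
Qed.

(** Summing over a set closed under arcs makes the induction work. A vertex of maximal height is not
    a head of an arc from [D], and its count is at most 1 plus the sum over the rest of [D], as the
    graph is simple; so adding it at most doubles the sum plus 1. *)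
Lemma num_paths_closed (D : {set V}) c :
  (forall v x, v \in D -> arc v x -> x \in D) ->
  (\sum_(v in D) num_paths arc wt v t c).+1 <= 2 ^ #|D|.
Proof.
have [k] := ubnP #|D|; elim: k D => // k IH D hk hD.
case: (set_0Vmem D) => [->|[v0 hv0]]; first by rewrite big_set0 cards0.
case: (arg_maxnP height hv0) => v hv' hmax; have hv : v \in D := hv'.
have hD' u x : u \in D :\ v -> arc u x -> x \in D :\ v.
  rewrite !inE => /andP[_ hu] hux; rewrite (hD u x hu hux) andbT.
  apply/eqP => e; have := height_arc hux; rewrite e ltnNge.
  by have /= -> := hmax u hu.
have hc : #|D| = #|D :\ v|.+1 by rewrite (cardsD1 v) hv.
have hk' : #|D :\ v| < k by rewrite -ltnS -hc.
have := IH _ hk' hD'; rewrite (big_setD1 v hv) /= hc expnS mul2n -addnn => hsum.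
have hv1 : num_paths arc wt v t c <= 1 + \sum_(x in D :\ v) num_paths arc wt x t c.
  rewrite num_paths_rec leq_add ?leq_b1 //.
  apply: (@leq_trans (\sum_(x | arc v x && (wt v x <= c)) num_paths arc wt x t c)).
    by apply: leq_sum => x _; apply: num_paths_mono; exact: leq_subr.
  rewrite big_mkcond [leqRHS]big_mkcond /=; apply: leq_sum => x _.
  case: ifP => // /andP[hx _]; rewrite ifT // !inE (hD v x hv hx) andbT.
  by apply/eqP => e; have := height_arc hx; rewrite e ltnn.
lia.
Qed.

Lemma num_paths_le v c : num_paths arc wt v t c <= 2 ^ #|V|.
Proof.
have h := @num_paths_closed setT c (fun _ _ _ _ => in_setT _).
rewrite cardsT in h; apply: leq_trans (ltnW h).
by rewrite (big_setD1 v) ?inE //= leq_addr.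
Qed.

Variable arcs : seq (V * V).
Hypothesis uniq_arcs : uniq arcs.
Hypothesis mem_arcs : forall u v, ((u, v) \in arcs) = arc u v.

Lemma sum_arcs v (f : V -> nat) :
  \sum_(x | arc v x) f x = \sum_(e <- arcs | e.1 == v) f e.2.
Proof.
rewrite [RHS]big_mkcond big_uniq // [RHS]big_mkcond /=.
pose F u x := if arc u x && (u == v) then f x else 0.
transitivity (\sum_e F e.1 e.2); last first.
  by apply: eq_bigr => -[u x] _; rewrite /F mem_arcs /=; case: (arc u x).
rewrite -(pair_bigA _ F) /= [RHS](bigD1 v) //= [X in _ + X]big1 => [|u /negbTE hu].
  by rewrite addn0 big_mkcond; apply: eq_bigr => x _; rewrite /F eqxx andbT.
by rewrite big1 // => x _; rewrite /F hu andbF.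
Qed.

End Paths.

(** * Correctness and running time *)

Section Total.

Variables (n m M K b U Q E : nat).

Definition total_time :=
  setup_time n K b U Q + (rounds_time n m K U + output_time n K U).

(** Unfolded, the time is a sum of monomials, each at most m K U because K dominates n^2, n (3 + Q)
    and b. The constant 1000 absorbs the lengths of the program pieces. *)
Lemma total_time_le : 0 < n -> 0 < m -> 0 < E -> b <= K ->
  M = n * (3 + Q) * (E + E) -> K = n.+2 * M ->
  total_time <= 1000 * (m * K * U).
Proof.
move=> n0 m0 E0 hb hM hK.
have x_M : n * (3 + Q) <= M by rewrite hM leq_pmulr; lia.
have nQ_M : n + Q <= M.
  by move: x_M; rewrite mulnDr; have := leq_pmull Q n0; lia.
have nM_K : n * M + M + M = K by rewrite hK !mulSn; lia.
have nn_K : n * n <= K.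
  have : n * n <= n * M by rewrite leq_mul2l; lia.
  by lia.
have c1 : K <= m * K by rewrite leq_pmull.
have c2 : m * (n * n) <= m * K by rewrite leq_mul2l nn_K orbT.
have c3 : m <= m * K by rewrite leq_pmulr; lia.
have scale x : x <= m * K -> x * U <= m * K * U by move=> h; rewrite leq_mul2r h orbT.
have e1 : U <= m * K * U by have := scale 1; rewrite mul1n; apply; lia.
have e2 : K * U <= m * K * U by exact: scale.
have e3 : Q * U <= m * K * U by apply: scale; lia.
have e4 : n * U <= m * K * U by apply: scale; lia.
have e5 : n * (3 + Q) * U <= m * K * U by apply: scale; lia.
have e6 : b * U <= m * K * U by apply: scale; lia.
have e7 : m * U <= m * K * U by exact: scale.
have e8 : n * n * U <= m * K * U by apply: scale; lia.
have e9 : m * (n * n) * U <= m * K * U by exact: scale.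
rewrite /total_time /setup_time /parameters_time /rounds_time /output_time.
rewrite /double_time /multiply_time /vertex_time /small_time /big_time.
rewrite /check_time /gather_arc_time /copy_budget /copy_time /merge_time /=.
by clear -e1 e2 e3 e4 e5 e6 e7 e8 e9; nia.
Qed.

End Total.

(** * Word lengths *)

Lemma words_linear l a b c : 0 < l -> a <= b * l + (c + c) ->
  words l a <= b + (c %/ l + c %/ l) + 2.
Proof.
move=> hl ha; rewrite /words addnS ltnS (leq_trans (leq_div2r l ha)) //.
rewrite divnMDl // addn1 -addnS leq_add2l -ltnS ltn_divLR //.
by have := ltn_ceil c hl; rewrite !mulSn mulnDl; lia.
Qed.

(** The address bound X is polynomial in n up to a single factor E, so it has O(log n + log E) bits;
    this is the source of the last factor of the running time. The capacity enters Y only, where the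
    longer words [L] absorb it. *)
Lemma unit_le n m C M K b X Y Q E :
  let l := nbits n in let L := nbits n + nbits C in
  0 < n -> 0 < E -> m <= (n * n).+1 -> (forall j, j < Q -> n * 2 ^ j < m) ->
  M = n * (3 + Q) * (E + E) -> K = n.+2 * M -> 2 ^ b <= K + K ->
  X = (m + m + 4) * 2 ^ b + n + 3 -> Y = X + C.+1 + C.+1 ->
  words l (nbits X + nbits X) + words L (nbits Y + nbits Y)
  <= 60 * (nbits E %/ nbits n).+1.
Proof.
move=> l L hn hE hm hQ hM hK hS hX hY.
have hl : 0 < l by rewrite /l /nbits up_log_gt0.
have hQn : Q <= n.
  case: Q hQ {hM} => // Q /(_ Q (ltnSn Q)) h.
  have : n * 2 ^ Q <= n * n by lia.
  by rewrite leq_pmul2l //; apply: leq_trans; exact: ltn_expl.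
have hnN : n < 2 ^ l := ltn_nbits n.
have hEP : E < 2 ^ nbits E := ltn_nbits E.
have hCG : C < 2 ^ nbits C := ltn_nbits C.
set e := nbits E in hEP *; set g := nbits C in hCG L *.
(* With N = 2 ^ l > n and P = 2 ^ e > E, the lists take at most 48 N ^ 5 P cells; the factor 64
   leaves room for the remaining terms. *)
have hX1 : X < 2 ^ (5 * l + e + 6).
  have -> : 2 ^ (5 * l + e + 6) = 64 * ((2 ^ l) ^ 5 * 2 ^ e).
    by rewrite 2!expnD [5 * l]mulnC expnM mulnC.
  rewrite hX.
  move: hS hnN hEP; set N := 2 ^ l; set P := 2 ^ e; move: (2 ^ b) => S hS hnN hEP.
  have hM1 : M <= 4 * (N * N * P).
    rewrite hM; apply: (@leq_trans (N * (2 * N) * (P + P))); last by nia.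
    by apply: leq_mul; [apply: leq_mul|]; lia.
  have hK1 : K <= 8 * (N * N * N * P).
    rewrite hK; apply: (@leq_trans ((2 * N) * (4 * (N * N * P)))); last by nia.
    by apply: leq_mul; lia.
  have hS1 : S <= 16 * (N * N * N * P) by lia.
  have hmN : m + m + 4 <= 3 * (N * N) by nia.
  have : (m + m + 4) * S <= 3 * (N * N) * (16 * (N * N * N * P)) by apply: leq_mul.
  have hNP : N <= N * (N * N * N * N * P) by rewrite leq_pmulr // !muln_gt0; lia.
  rewrite (_ : N ^ 5 = N * N * N * N * N) //; last by rewrite !expnS expn0 muln1 !mulnA.
  have hN2 : n + 3 <= N + 2 by lia.
  nia.
have hX2 : nbits X <= 5 * l + e + 6 by exact: nbits_lt_exp.
have hY2 : nbits Y <= 5 * l + e + 6 + g + 1.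
  apply: nbits_lt_exp; rewrite hY addn1 expnS expnD.
  move: hX1 hCG; set p := 2 ^ _; set q := 2 ^ g => h1 h2; nia.
have h1 : words l (nbits X + nbits X) <= 22 + (e %/ l + e %/ l) + 2.
  by apply: words_linear => //; lia.
have h2 : words L (nbits Y + nbits Y) <= 24 + (e %/ L + e %/ L) + 2.
  by apply: words_linear; rewrite /L; lia.
have h3 : e %/ L <= e %/ l by rewrite leq_div2l // /L leq_addr.
apply: leq_trans (leq_add h1 h2) _.
by rewrite -/e -/l; move: (e %/ l) (e %/ L) h3 => q q'; lia.
Qed.

(** * The graph with the additional vertex *)

Section Correctness.

Variables (n : nat) (arc : rel 'I_n) (wt : 'I_n -> 'I_n -> nat).
Variables (arcs : seq ('I_n * 'I_n)) (s t : 'I_n) (C E : nat).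
Hypothesis n_gt0 : 0 < n.
Hypothesis E_gt0 : 0 < E.
Hypothesis arc_acyclic : acyclic arc.
Hypothesis uniq_arcs : uniq arcs.
Hypothesis mem_arcs : forall u v, ((u, v) \in arcs) = arc u v.

Let m0 := size arcs.
(** The default values describe the additional arc at position [m0], from [t] to [n] with weight
    0. *)
Let tl := nth (t : nat) [seq val uv.1 | uv <- arcs].
Let hd := nth n [seq val uv.2 | uv <- arcs].
Let wta := nth 0 [seq wt uv.1 uv.2 | uv <- arcs].

(* The additional vertex [n] reaches itself by the empty path only. *)
Let F (v c : nat) : nat :=
  if insub v is Some v' then num_paths arc wt v' t c else 1.

Let F_ord (v : 'I_n) c : F v c = num_paths arc wt v t c.
Proof. by rewrite /F valK. Qed.

Let F_last c : F n c = 1.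
Proof. by rewrite /F insubF ?ltnn. Qed.

Let height_nat (v : nat) : nat :=
  if insub v is Some v' then height arc v' else 0.

Let height_ord (v : 'I_n) : height_nat v = height arc v.
Proof. by rewrite /height_nat valK. Qed.

Let nth_arc a : a < m0 -> exists e, [/\ e \in arcs, tl a = e.1, hd a = e.2
  & wta a = wt e.1 e.2].
Proof.
move=> ha; pose e := nth (t, t) arcs a; exists e; split; first exact: mem_nth.
- by rewrite /tl (nth_map (t, t)).
- by rewrite /hd (nth_map (t, t)).
- by rewrite /wta (nth_map (t, t)).
Qed.

Let tl_last : tl m0 = t.
Proof. by rewrite /tl nth_default ?size_map. Qed.

Let hd_last : hd m0 = n.
Proof. by rewrite /hd nth_default ?size_map. Qed.

Let wta_last : wta m0 = 0.
Proof. by rewrite /wta nth_default ?size_map. Qed.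

Let tl_lt a : a < m0.+1 -> tl a < n.
Proof.
rewrite ltnS leq_eqVlt => /orP[/eqP->|ha]; first by rewrite tl_last.
by have [e [_ -> _ _]] := nth_arc ha.
Qed.

Let hd_le a : a < m0.+1 -> hd a <= n.
Proof.
rewrite ltnS leq_eqVlt => /orP[/eqP->|ha]; first by rewrite hd_last.
by have [e [_ _ -> _]] := nth_arc ha; exact: ltnW.
Qed.

Let height_arcs a : a < m0.+1 -> hd a < n -> height_nat (hd a) < height_nat (tl a).
Proof.
rewrite ltnS leq_eqVlt => /orP[/eqP->|ha]; first by rewrite hd_last ltnn.
have [[u v] [he -> -> _]] := nth_arc ha => _; rewrite !height_ord.
by apply: height_arc => //; rewrite -mem_arcs.
Qed.

Let height_nat_lt v : v < n -> height_nat v < n.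
Proof.
move=> hv; rewrite -[v]/(val (Ordinal hv)) height_ord.
by have := height_lt arc (Ordinal hv); rewrite card_ord.
Qed.

Let F_rec v c : v < n -> c <= C -> F v c = paths_upto tl hd wta F v m0.+1 c.
Proof.
move=> hv _; rewrite paths_uptoS tl_last /arc_paths wta_last hd_last F_last leq0n.
rewrite -[v]/(val (Ordinal hv)) F_ord num_paths_rec // addnC; congr (_ + _); last first.
  by rewrite eq_sym -val_eqE; case: eqP.
rewrite big_mkcondr /= (sum_arcs uniq_arcs mem_arcs) (big_nth (t, t)).
rewrite /paths_upto big_nat_cond [RHS]big_nat_cond; apply: eq_big => [a|a].
  case: ltnP => //= ha; rewrite /tl (nth_map (t, t)) //.
case/andP => /andP[_ ha] /eqP hta; rewrite /arc_paths /wta /hd !(nth_map (t, t)) //.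
by rewrite hta F_ord.
Qed.

Let F_le v c : v < n -> F v c <= 2 ^ n.
Proof.
move=> hv; rewrite -[v]/(val (Ordinal hv)) F_ord.
by have := num_paths_le wt t arc_acyclic (Ordinal hv) c; rewrite card_ord.
Qed.

Lemma approx_count_correct :
  let l := nbits n in
  let L := nbits n + nbits C in
  exists k final Q,
  [/\ exec l L approx_count (init_state arcs wt s t C E) k final,
      reg final out_reg <= num_paths arc wt s t C,
      num_paths arc wt s t C * E
        <= reg final out_reg * E + num_paths arc wt s t C,
      forall j, j < Q -> n * 2 ^ j <= size arcs &
      k <= 1000 * ((size arcs).+1 * (n.+2 * (n * (3 + Q) * (E + E)))
                   * (60 * (nbits E %/ nbits n).+1))].
Proof.
move=> l L.
(* Q is the least exponent with m0 + 1 <= n 2 ^ Q, the one that the program finds by doubling.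
   Minimality yields n 2 ^ j <= m0 for j < Q, which later bounds Q by the logarithm. *)
have hex : exists i, m0.+1 <= n * 2 ^ i.
  exists m0.+1; apply: leq_trans (ltnW (ltn_expl m0.+1 (ltnSn 1))) _.
  by rewrite leq_pmull.
have [Q hQ hQmin'] := ex_minnP hex.
have hQmin j : j < Q -> n * 2 ^ j < m0.+1.
  by move=> h; rewrite ltnNge; apply/negP => /hQmin'; rewrite leqNgt h.
have [M hM] : exists M, M = n * (3 + Q) * (E + E) by eexists.
have [K hK] : exists K, K = n.+2 * M by eexists.
have K_gt0 : 0 < K.
  have EE_gt0 : 0 < E + E by rewrite addn_gt0 E_gt0.
  by rewrite hK hM !muln_gt0 n_gt0 EE_gt0.
have [b hb] : exists b, b = nbits K by eexists.
have hKS : K < 2 ^ b by rewrite hb ltn_nbits.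
have hbmin j : j < b -> 2 ^ j <= K.
  rewrite hb => h; rewrite leqNgt; apply/negP => /nbits_lt_exp.
  by rewrite leqNgt h.
have hbK : b <= K by rewrite hb nbits_le.
have hS2 : 2 ^ b <= K + K.
  case: b hbmin {hb hKS hbK} => [|b] h; first by rewrite expn0; lia.
  by rewrite expnS mul2n -addnn leq_add ?h.
have [X hX] : exists X, X = (m0.+1 + m0.+1 + 4) * 2 ^ b + n + 3 by eexists.
have [Y hY] : exists Y, Y = X + C.+1 + C.+1 by eexists.
have [U hU] : exists U, U = words l (nbits X + nbits X) + words L (nbits Y + nbits Y).
  by eexists.
have short_unit : words l (nbits X + nbits X) <= U by rewrite hU leq_addr.
have long_unit : words L (nbits Y + nbits Y) <= U by rewrite hU leq_addl.
have hm0 : m0 <= n * n.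
  rewrite /m0; have /card_uniqP <- := uniq_arcs; apply: leq_trans (max_card _) _.
  by rewrite card_prod card_ord.
have hUle : U <= 60 * (nbits E %/ nbits n).+1.
  rewrite hU; exact: (unit_le n_gt0 E_gt0 _ hQmin hM hK hS2 hX hY).
have M_gt1 : 1 < M.
  by rewrite hM; nia.
have F_bound v c : v < n -> c <= C -> F v c < gval M K.
  move=> hv _; apply: leq_ltn_trans (F_le c hv) _; rewrite hK; exact: gval_large.
have hsz := setup_sizes hM hK erefl hX hY n_gt0 (ltn0Sn m0) E_gt0 hQ hKS short_unit long_unit.
have init_arc a : a < m0 -> nth 0 [seq val uv.1 | uv <- arcs] a = tl a /\
    nth 0 [seq val uv.2 | uv <- arcs] a = hd a.
  by move=> ha; split; apply: set_nth_default; rewrite size_map.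
have hwp : wp l L approx_count (init_state arcs wt s t C E)
    (total_time n m0.+1 K b U Q) (fun sg' =>
      reg sg' out_reg <= F s C /\ exists2 R, R <= n * (Q + 3) &
      F s C * M <= reg sg' out_reg * M + 2 * R * F s C).
  apply: wp_seq; apply: wp_weaken (leqnn _) _.
    apply: (wp_setup hM hK erefl hX hY n_gt0 (ltn0Sn m0) E_gt0 hQ hQmin hKS hbmin
      short_unit long_unit F_last (tl := tl) (hd := hd) (wt := wta) (t := t)) => //.
    by move=> v _; rewrite /= nth_nil.
  move=> sg1 [hI hn1 r2].
  apply: wp_seq; apply: wp_weaken (leqnn _) _.
    apply: (wp_rounds hsz F_rec F_bound tl_lt hd_le height_arcs height_nat_lt
      n_gt0 (Q := Q) _ hI hn1).
    by rewrite -addnn (leq_trans hQ) ?leq_addr.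
  move=> sg2 [R [hI2 hR hreg hdone]].
  have r2' : reg sg2 2 = s by rewrite hreg.
  apply: wp_weaken (wp_output hsz hI2 r2' (ltn_ord s)
    (F_le C (ltn_ord s)) (hdone _ (ltnW (ltn_ord s)))) (leqnn _) _.
  by move=> sg3 [h1 h2]; split=> //; exists R.
have [k [final [hx hk [hZ [R hR hA]]]]] := hwp.
exists k, final, Q; rewrite -F_ord; split=> //.
(* As R <= n (3 + Q) and M = 2 E n (3 + Q), the relative error 2 R / M is at most 1 / E; the common
   factor 2 n (3 + Q) is cancelled. *)
- have hR2 : 2 * R * F s C <= 2 * (n * (3 + Q)) * F s C.
    by rewrite leq_mul2r leq_mul2l addnC hR !orbT.
  have h := leq_trans hA (leq_add (leqnn _) hR2).
  have x_gt0 : 0 < 2 * (n * (3 + Q)) by rewrite !muln_gt0 n_gt0.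
  rewrite -(leq_pmul2l x_gt0); move: h; rewrite hM.
  by move: (n * (3 + Q)) (F s C) (reg _ _) => x f z; lia.
- apply: leq_trans hk _.
  apply: leq_trans (total_time_le U n_gt0 (ltn0Sn m0) E_gt0 hbK hM hK) _.
  by rewrite -hM -hK leq_mul2l leq_mul2l hUle !orbT.
Qed.

End Correctness.

(** * Translation into real logarithms and epsilon *)

Section RealBounds.

Import Order.TTheory GRing.Theory Num.Theory.
Local Open Scope ring_scope.

Variable R : realType.
Implicit Types x eps : R.

Lemma lg_ge1 x : 1 <= lg x.
Proof. by rewrite /lg le_max lexx. Qed.

Lemma lg_gt0 x : 0 < lg x.
Proof. exact: lt_le_trans ltr01 (lg_ge1 x). Qed.

Let ln2_gt0 : 0 < ln 2%:R :> R.
Proof. by rewrite ln_gt0 // ltr1n. Qed.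

Lemma lg_ge_exp j x : (2 ^ j)%N%:R <= x -> j%:R <= lg x.
Proof.
move=> h; rewrite /lg le_max ler_pdivlMr //; apply/orP; right.
have e2 : (0 : R) < (2 ^ j)%N%:R by rewrite ltr0n expn_gt0.
rewrite mulr_natl -lnXn ?ltr0n // -natrX.
by rewrite ler_ln ?posrE // (lt_le_trans e2).
Qed.

Lemma lg_le_exp j n : (0 < j)%N -> (n <= 2 ^ j)%N -> lg n%:R <= j%:R :> R.
Proof.
move=> hj h; rewrite /lg ge_max ler1n hj /= ler_pdivrMr //.
case: (posnP n) => [->|n_gt0].
  by rewrite ln0 // mulr_ge0 // ltW.
rewrite mulr_natl -lnXn ?ltr0n // -natrX.
by rewrite ler_ln ?posrE ?ltr0n ?expn_gt0 // ler_nat.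
Qed.

(** Minimality of Q gives Q - 1 <= lg (m / n) for Q > 0, and the convention that [lg] is at least 1
    pays for the additive constant 4. *)
Lemma depth_real n m Q : (0 < n)%N ->
  (forall j, (j < Q)%N -> (n * 2 ^ j <= m)%N) ->
  (3 + Q)%:R <= 5 * lg (m%:R / n%:R : R).
Proof.
move=> n_gt0 hQ; have := lg_ge1 (m%:R / n%:R : R).
case: Q hQ => [|j] hQ h; first by rewrite addn0; lra.
have : j%:R <= lg (m%:R / n%:R : R).
  apply: lg_ge_exp; rewrite ler_pdivlMr ?ltr0n // -natrM ler_nat mulnC.
  exact: hQ.
rewrite natrD -natr1; lra.
Qed.

Section Accuracy.

Variable eps : R.
Hypothesis eps_bounds : 0 < eps <= 1.

Let E := `|Num.ceil (eps^-1)|%N.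

Let eps_gt0 : 0 < eps.
Proof. by case/andP: eps_bounds. Qed.

Let inv_ge1 : 1 <= eps^-1.
Proof. by rewrite invf_ge1 //; case/andP: eps_bounds. Qed.

Let natE : E%:R = (Num.ceil (eps^-1))%:~R :> R.
Proof.
rewrite /E natr_absz ger0_norm // ceil_ge0 (lt_le_trans _ inv_ge1) //.
by rewrite (lt_trans _ ltr01) // ltrN10.
Qed.

Lemma accuracy_ge : eps^-1 <= E%:R.
Proof. by rewrite natE ceil_ge. Qed.

Lemma accuracy_gt0 : (0 < E)%N.
Proof. by rewrite -(ltr0n R); apply: lt_le_trans accuracy_ge; rewrite invr_gt0. Qed.

Lemma accuracy_le : E%:R <= 2 * eps^-1.
Proof.
have : (Num.ceil (eps^-1) - 1)%:~R < eps^-1 by exact: ceilB1_lt.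
by have := inv_ge1; rewrite natE intrB; lra.
Qed.

Lemma accuracy_error N Z : (N * E <= Z * E + N)%N ->
  (1 - eps) * N%:R <= Z%:R.
Proof.
have E_gt0 : 0 < E%:R :> R by rewrite ltr0n accuracy_gt0.
rewrite -(ler_nat R) natrD !natrM => h; rewrite -(ler_pM2r E_gt0).
have : 1 <= eps * E%:R by rewrite -ler_pdivrMl // mulr1 accuracy_ge.
have : 0 <= N%:R :> R by [].
move: h; move: (E%:R : R) (N%:R : R) (Z%:R : R) => e x z h hx he.
have : x <= eps * e * x by rewrite ler_peMl.
by lra.
Qed.

(** From E <= 2 / eps the length of E is at most lg (1 / eps) + 2, hence at most 3 lg (1 / eps),
    while that of n is at least lg n. The fourth unit pays for the successor, as the ceiling is at
    least 1. *)
Lemma word_real n : (0 < n)%N ->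
  (nbits E %/ nbits n).+1%:R
  <= 4 * (Num.ceil (lg eps^-1 / lg (n%:R : R)))%:~R :> R.
Proof.
move=> n_gt0; set W := lg _ / lg _.
have W_gt0 : 0 < W by rewrite divr_gt0 ?lg_gt0.
have hW : W <= (Num.ceil W)%:~R by exact: ceil_ge.
have hW1 : 1 <= (Num.ceil W)%:~R :> R.
  by rewrite (ler_int R 1) -gtz0_ge1 ceil_gt0.
have l_gt0 : (0 < nbits n)%N by rewrite /nbits up_log_gt0.
have hl : lg n%:R <= (nbits n)%:R :> R.
  by rewrite lg_le_exp // ltnW // ltn_nbits.
have hlr : 0 < (nbits n)%:R :> R by rewrite ltr0n.
have he : (nbits E)%:R <= 3 * lg eps^-1.
  have := lg_ge1 eps^-1; have E_gt0 := accuracy_gt0.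
  case hE : (nbits E) => [|[|j]] h1; try lra.
  have : (2 ^ j.+1 <= E)%N.
    have := @up_log_gtn 2 E.+1 isT; rewrite -/(nbits E) hE ltnS /=; exact.
  rewrite -(ler_nat R) expnS natrM => h2.
  have h3 : j%:R <= lg eps^-1.
    by apply: lg_ge_exp; have := accuracy_le; lra.
  by rewrite -!natr1; lra.
have : (nbits E %/ nbits n)%:R <= 3 * W.
  rewrite /W mulrA ler_pdivlMr ?lg_gt0 //.
  apply: le_trans he; apply: le_trans (_ : (nbits E %/ nbits n * nbits n)%:R <= _).
    by rewrite natrM ler_wpM2l.
  by rewrite ler_nat leq_divM.
by rewrite -natr1; lra.
Qed.

(** The factor 120 = 2 * 3 * 5 * 4 collects m + 1 <= 2 max(1, m), n + 2 <= 3 n, 3 + Q <= 5 lg (m /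
    n) and 2 E <= 4 / eps; the factor 240 = 60 * 4 comes from the word lengths. *)
Lemma time_real n m Q k : (0 < n)%N ->
  (forall j, (j < Q)%N -> (n * 2 ^ j <= m)%N) ->
  (k <= 1000 * (m.+1 * (n.+2 * (n * (3 + Q) * (E + E)))
                * (60 * (nbits E %/ nbits n).+1)))%N ->
  k%:R <= 1000 * 120 * 240 * time_bound n m eps.
Proof.
move=> n_gt0 hQ.
have h4 : (n.+2 <= 3 * n)%N by clear -n_gt0; lia.
have h5 : (m.+1 <= 2 * maxn 1 m)%N by clear; lia.
rewrite -(ler_nat R) natrM in h4; rewrite -(ler_nat R) natrM in h5.
rewrite -(ler_nat R) !natrM => hk; apply: (le_trans hk); rewrite /time_bound.
have h1 := depth_real n_gt0 hQ.
have h2 := word_real n_gt0.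
have h3 : (E + E)%:R <= 4 * eps^-1.
  by have := accuracy_le; rewrite natrD; lra.
move: h1 h2 h3; set w := (Num.ceil _)%:~R; set a := lg _ => h1 h2 h3.
have h6 : m.+1%:R * (n.+2%:R * (n%:R * (3 + Q)%:R * (E + E)%:R))
      * (60 * (nbits E %/ nbits n).+1%:R)
    <= 2 * (maxn 1 m)%:R * (3 * n%:R * (n%:R * (5 * a) * (4 * eps^-1)))
      * (60 * (4 * w)).
  by rewrite !ler_pM ?mulr_ge0.
apply: le_trans (ler_wpM2l _ h6) _; first by [].
by rewrite le_eqVlt; apply/orP; left; apply/eqP; ring.
Qed.

End Accuracy.

End RealBounds.

Theorem theorem5 (R : realType) :
  exists (P : cmd) (c : nat),
  forall (n : nat) (arc : rel 'I_n) (wt : 'I_n -> 'I_n -> nat)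
         (arcs : seq ('I_n * 'I_n)) (s t : 'I_n) (C : nat) (eps : R),
  (1 <= n)%N ->
  acyclic arc ->
  uniq arcs ->
  (forall u v : 'I_n, ((u, v) \in arcs) = arc u v) ->
  (0 < eps <= 1)%R ->
  let N := num_paths arc wt s t C in
  let l := nbits n in
  let L := (nbits n + nbits C)%N in
  let E := `|Num.ceil (eps^-1)%R|%N in
  exists (k : nat) (final : state),
    exec l L P (init_state arcs wt s t C E) k final /\
    let Z := reg final out_reg in
    ((1 - eps) * N%:R <= Z%:R :> R)%R /\
    (Z <= N)%N /\
    (k%:R <= c%:R * time_bound n (size arcs) eps)%R.

Proof.
exists approx_count.
have [c hc] : exists c : nat, (c%:R = 1000 * 120 * 240 :> R)%R.
  by exists (1000 * 120 * 240)%N; rewrite !GRing.natrM.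
exists c => n arc wt arcs s t C eps n_gt0 arc_acyclic uniq_arcs mem_arcs he N l L E.
have E_gt0 : 0 < E by exact: accuracy_gt0 he.
have [k [final [Q [hx hZ hN hQ hk]]]] := approx_count_correct wt s t C n_gt0 E_gt0
  arc_acyclic uniq_arcs mem_arcs.
exists k, final; split=> // Z; split; first exact: (accuracy_error he hN).
by split=> //; rewrite hc; exact: (time_real he n_gt0 hQ hk).
Qed.
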